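(* Given $d\ge 1$, a matrix $M\in\mathbb{Q}^{d\times d}$, a vector $q\in\mathbb{Q}^d$ and a polynomial weight function $w\in\mathbb{Q}[X_1,\ldots,X_d]$, it is decidable whether the mean payoff $\mathcal{MP}_w(M,q)$ exists; and when it exists, it is a rational number that is effectively computable (from $M$, $q$, $w$).
   Context: For $M\in\mathbb{Q}^{d\times d}$, $q\in\mathbb{Q}^d$ and a function $w\colon\mathbb{R}^d\to\mathbb{R}$, the mean payoff of the orbit $(M^nq)_{n\in\mathbb{N}}$ is $$\mathcal{MP}_w(M,q)=\lim_{n\to\infty}\frac1n\sum_{k=0}^{n-1}w(M^kq).$$ The mean payoff exists if this limit exists in $\mathbb{R}$. ''Decidable'' and ''effectively computable'' mean that there is a single algorithm taking $(M,q,w)$ as input. *)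

(* Defs.v *)
From HB Require Import structures.
From mathcomp Require Import all_boot all_order all_algebra.
From mathcomp Require Import boolp classical_sets reals topology normedtype.
From mathcomp Require Import sequences.
From mathcomp Require mpoly.
(* The notations of mpoly clash with those of MathComp-Analysis. *)
Import -(notations) mpoly.
Import numFieldNormedType.Exports.

Set Implicit Arguments.
Unset Strict Implicit.
Unset Printing Implicit Defensive.

Import Order.TTheory GRing.Theory Num.Theory.

Local Open Scope classical_set_scope.
Local Open Scope ring_scope.

(** * Mean payoff *)

Section MeanPayoff.
Variables (R : realType) (d : nat).
Implicit Types (M : 'M[rat]_d) (q : 'cV[rat]_d) (w : 'cV[R]_d -> R).

Definition orbit_point M q (k : nat) : 'cV[R]_d :=
  map_mx (ratr : rat -> R) (M ^+ k *m q).

(* The value at n = 0 is junk (0^-1 = 0) and irrelevant for the limit. *)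
Definition payoff_average w M q : R^nat :=
  fun n => n%:R^-1 * \sum_(0 <= k < n) w (orbit_point M q k).

Definition mean_payoff_exists w M q : Prop := cvgn (payoff_average w M q).

(* Meaningful only when mean_payoff_exists w M q holds. *)
Definition mean_payoff w M q : R := limn (payoff_average w M q).

Definition poly_weight (p : mpoly d rat) : 'cV[R]_d -> R :=
  fun x => meval (fun i => x i 0) (map_mpoly (ratr : rat -> R) p).

End MeanPayoff.

Arguments poly_weight R {d} p _.

(** * Partial recursive functions *)

Inductive recfun : nat -> Type :=
| RZero n : recfun n
| RSucc : recfun 1
| RProj n (i : 'I_n) : recfun n
| RComp m n (g : recfun m) (h : 'I_m -> recfun n) : recfun n
| RPrim n (g : recfun n) (h : recfun n.+2) : recfun n.+1
| RMu n (f : recfun n.+1) : recfun n.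

(* [reval f v y]: the partial function f is defined at v, with value y.
   In a primitive recursion f(0, x) = g(x), f(k + 1, x) = h(k, f(k, x), x), the
   function s lists the intermediate values f(0, x), ..., f(n, x).
   [RMu f] maps x to the least y such that f(y, x) = 0, provided that f(k, x) is
   defined for all k < y. *)
Fixpoint reval n (f : recfun n) : n.-tuple nat -> nat -> Prop :=
  match f in recfun n return n.-tuple nat -> nat -> Prop with
  | RZero _ => fun _ y => y = 0%N
  | RSucc => fun v y => y = (thead v).+1
  | RProj _ i => fun v y => y = tnth v i
  | RComp m _ g h => fun v y =>
      exists u : m.-tuple nat,
        (forall i, reval (h i) v (tnth u i)) /\ reval g u y
  | RPrim _ g h => fun v y =>
      exists s : nat -> nat,
        [/\ reval g [tuple of behead v] (s 0%N),
            forall k, (k < thead v)%N ->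
              reval h [tuple of k :: s k :: behead v] (s k.+1)
          & y = s (thead v)]
  | RMu _ f => fun v y =>
      reval f [tuple of y :: v] 0%N /\
      forall k, (k < y)%N -> exists z, reval f [tuple of k :: v] z.+1
  end.

Lemma reval_functional n (f : recfun n) v y1 y2 :
  reval f v y1 -> reval f v y2 -> y1 = y2.
Proof.
elim: f v y1 y2 => {n} /=.
- by move=> n v y1 y2 -> ->.
- by move=> v y1 y2 -> ->.
- by move=> n i v y1 y2 -> ->.
- move=> m n g IHg h IHh v y1 y2 [u1 [hu1 gu1]] [u2 [hu2 gu2]].
  suff e : u1 = u2 by apply: (IHg u1) => //; rewrite e.
  by apply: eq_from_tnth => i; apply: (IHh i v).
- move=> n g IHg h IHh v y1 y2 [s1 [g1 h1 ->]] [s2 [g2 h2 ->]].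
  suff H k : (k <= thead v)%N -> s1 k = s2 k by exact: H.
  elim: k => [_|k IHk lt_kv]; first exact: IHg g1 g2.
  have := h1 k lt_kv; rewrite (IHk (ltnW lt_kv)) => h1k.
  exact: IHh h1k (h2 k lt_kv).
- move=> n f IHf v y1 y2 [f1 lt1] [f2 lt2].
  case: (ltngtP y1 y2) => // lt_y.
    by have [z /(IHf _ _ _ f1)] := lt2 _ lt_y.
  by have [z /(IHf _ _ _ f2)] := lt1 _ lt_y.
Qed.

(** * Encoding of inputs and outputs as natural numbers *)

(* [CodeSeq.code] is a computable bijection from seq nat to nat. *)

Definition code_int (z : int) : nat :=
  match z with Posz n => n.*2 | Negz n => n.*2.+1 end.

Definition code_rat (r : rat) : nat :=
  CodeSeq.code [:: code_int (numq r); code_int (denq r)].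

Definition code_rats (s : seq rat) : nat := CodeSeq.code (map code_rat s).

Definition code_vec d (q : 'cV[rat]_d) : nat :=
  code_rats [seq q i 0 | i <- enum 'I_d].

Definition code_mat d (M : 'M[rat]_d) : nat :=
  CodeSeq.code [seq code_rats [seq M i j | j <- enum 'I_d] | i <- enum 'I_d].

Definition mpoly_of_terms d (s : seq (rat * multinom d)) : mpoly d rat :=
  \sum_(t <- s) t.1 *: mpolyX rat t.2.

Definition code_term d (t : rat * multinom d) : nat :=
  CodeSeq.code [:: code_rat t.1; CodeSeq.code [seq t.2 i | i <- enum 'I_d]].

Definition code_terms d (s : seq (rat * multinom d)) : nat :=
  CodeSeq.code (map (@code_term d) s).

(* A polynomial is input as any list of terms (coefficient, exponents) whose sum
   it is: the terms may come in any order, repeated, or with coefficient 0. *)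
Definition encodes d (M : 'M[rat]_d) (q : 'cV[rat]_d) (p : mpoly d rat)
    (c : nat) : Prop :=
  exists2 s : seq (rat * multinom d), p = mpoly_of_terms s &
    c = CodeSeq.code [:: d; code_mat M; code_vec q; code_terms s].

Lemma encodes_ex d (M : 'M[rat]_d) (q : 'cV[rat]_d) (p : mpoly d rat) :
  exists c, encodes M q p c.
Proof.
pose s := [seq (mcoeff m p, m) | m <- msupp p].
exists (CodeSeq.code [:: d; code_mat M; code_vec q; code_terms s]).
by exists s => //; rewrite /mpoly_of_terms /s big_map /=; exact: mpolyE.
Qed.

(* Main.v *)
(* Idea. The sequence u_k = w(M^k q) is rational and satisfies a linear
   recurrence of computable order N. If the mean payoff exists then u_k = o(k);
   conversely if u_k = o(k) then 1 is at most a simple root of the minimal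
   polynomial, some polynomial phi in the shift with phi(1) = 1 makes phi(E) u
   constant, and that rational constant is the mean payoff. Such a phi can be
   found by search, since an identity between shifts of u need only be checked
   on the first N terms.
   Decision of u_k = o(k): either some characteristic root has modulus > 1, and
   then |u_k| exceeds an explicit polynomial bound for some k, or all of them lie
   in the closed disc. In the second case there are rational polynomials f and
   g, with all roots of f on the unit circle and simple, all roots of g inside,
   such that f^N g annihilates u; then u_k = o(k) iff f g annihilates u. The root
   locations have certificates: g has its roots inside iff it has a multiple
   whose leading coefficient dominates the sum of the others, and by Cohn's
   theorem f has simple roots on the circle iff it is self-reciprocal and f'
   has its roots inside. One dovetailed search thus always terminates. *)

Require Import Defs.
From mathcomp Require Import all_boot all_order all_algebra all_field.
From mathcomp Require Import zify ring lra.
From mathcomp Require Import boolp classical_sets reals topology normedtype.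
From mathcomp Require Import sequences.
From mathcomp Require mpoly.
Import -(notations) mpoly.
Import numFieldNormedType.Exports.

Set Implicit Arguments.
Unset Strict Implicit.
Unset Printing Implicit Defensive.

Import Order.TTheory GRing.Theory Num.Theory.

(** * Total recursive functions *)

(** Algebraic numbers occur only in the correctness proofs, in [algC]. The programs handle rational
    numbers and rational polynomials, so every fact on the location of roots that they rely on is
    expressed by identities and inequalities between rational coefficients. Separating the roots of
    f from those of g must therefore be possible over the rationals. A rational polynomial has the
    conjugates of its roots, and on the circle the conjugate is the inverse; hence the circle roots
    are also roots of the reciprocal polynomial, and when all roots lie in the closed disc a gcd
    isolates them. The growth bound holds whenever all characteristic roots lie in the closed disc.
    This is the case for sublinear sequences, so exceeding the bound once refutes sublinearity;
    obeying it forever forces the roots into the disc, and then a certificate exists. The programs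
    are not written as terms of [recfun]: closure properties of computable functions on encoded
    types provide them, and each algorithm is one unbounded search over decoded candidates. *)

Definition recursive n (F : n.-tuple nat -> nat) : Prop :=
  exists f : recfun n, forall v, reval f v (F v).

Section TupleLevel.
Variable n : nat.
Implicit Types (F G : n.-tuple nat -> nat).

Lemma recursive_ext F G : F =1 G -> recursive F -> recursive G.
Proof. by move=> e [f hf]; exists f => v; rewrite -e. Qed.

Lemma recursive_proj (i : 'I_n) : recursive (fun v : n.-tuple nat => tnth v i).
Proof. by exists (RProj i). Qed.

Lemma recursive_comp m (G : m.-tuple nat -> nat) (H : 'I_m -> n.-tuple nat -> nat) :
  recursive G -> (forall i, recursive (H i)) ->
  recursive (fun v => G [tuple H i v | i < m]).
Proof.
move=> [g hg] hH; have [h hh] := boolp.choice hH.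
exists (RComp g h) => v /=; exists [tuple H i v | i < m]; split => // i.
by rewrite tnth_mktuple.
Qed.

Lemma recursive_succ F : recursive F -> recursive (fun v => (F v).+1).
Proof.
move=> cF; have hS : recursive (fun v : 1.-tuple nat => (thead v).+1).
  by exists RSucc.
apply: recursive_ext (recursive_comp hS (H := fun _ => F) (fun _ => cF)) => v.
by rewrite /thead tnth_mktuple.
Qed.

Lemma recursive_const k : recursive (fun _ : n.-tuple nat => k).
Proof. by elim: k => [|k /recursive_succ //]; exists (RZero n). Qed.

Lemma recursive_rec (A : n.-tuple nat -> nat) (B : n.+2.-tuple nat -> nat) N :
  recursive A -> recursive B -> recursive N ->
  recursive (fun v => nat_rect (fun=> nat) (A v)
                    (fun k acc => B [tuple of k :: acc :: v]) (N v)).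
Proof.
move=> [a ha] [b hb] cN.
(* [RPrim] recurses on the head of its argument tuple, so the count [N v] is prepended by a
   composition. *)
pose G (w : n.+1.-tuple nat) := nat_rect (fun=> nat) (A [tuple of behead w])
  (fun k acc => B [tuple of k :: acc :: behead w]) (thead w).
have cG : recursive G.
  exists (RPrim a b) => w /=.
  exists (nat_rect (fun=> nat) (A [tuple of behead w])
            (fun k acc => B [tuple of k :: acc :: behead w])).
  by split => // k _ /=; exact: hb.
pose H (i : 'I_n.+1) (v : n.-tuple nat) := tnth [tuple of N v :: v] i.
have cH i : recursive (H i).
  case: (unliftP ord0 i) => [j|] ->.
    by apply: recursive_ext (recursive_proj j) => v; rewrite /H tnthS.
  by apply: recursive_ext cN => v; rewrite /H tnth0.
apply: recursive_ext (recursive_comp cG cH) => v; rewrite /G /H.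
have -> : [tuple tnth [tuple of N v :: v] i | i < n.+1] = [tuple of N v :: v].
  by apply: eq_from_tnth => i; rewrite tnth_mktuple.
rewrite theadE; move: [tuple of N v :: v]
  (erefl : behead [tuple of N v :: v] = v) => w e.
elim: (N v) => [|k IHk] /=; first by congr A; exact: val_inj.
by rewrite IHk; congr B; apply: val_inj; rewrite /= e.
Qed.

Lemma recursive_mu (F : n.+1.-tuple nat -> nat) G :
  recursive F -> (forall v, F [tuple of G v :: v] = 0) ->
  (forall v k, k < G v -> F [tuple of k :: v] <> 0) ->
  recursive G.
Proof.
move=> [f hf] F0 Fn0; exists (RMu f) => v /=; split; first by rewrite -(F0 v).
move=> k /Fn0; case E : (F _) => [|z] // _; exists z; rewrite -E; exact: hf.
Qed.

End TupleLevel.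

Lemma recursive_behead n (F : n.-tuple nat -> nat) :
  recursive F -> recursive (fun v : n.+1.-tuple nat => F [tuple of behead v]).
Proof.
move=> cF; apply: recursive_ext
  (recursive_comp (H := fun i v => tnth v (lift ord0 i))
  cF (fun i => recursive_proj (lift ord0 i))) => v.
congr F; apply: eq_from_tnth => i; rewrite tnth_mktuple.
by rewrite !(tnth_nth 0) /= nth_behead.
Qed.

Lemma recursive_behead2 n (F : n.-tuple nat -> nat) : recursive F ->
  recursive (fun v : n.+2.-tuple nat => F [tuple of behead [tuple of behead v]]).
Proof. by move/recursive_behead/recursive_behead. Qed.

Lemma behead2_cons n (v : n.-tuple nat) k acc :
  [tuple of behead [tuple of behead (k :: acc :: v)]] = v.
Proof. exact: val_inj. Qed.

Section Arithmetic.
Variable n : nat.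
Implicit Types (A N F G : n.-tuple nat -> nat).

Lemma recursive_iter A N (B : nat -> nat -> n.-tuple nat -> nat) :
  recursive A -> recursive N ->
  recursive (fun w : n.+2.-tuple nat => B (tnth w ord0) (tnth w (lift ord0 ord0))
                               [tuple of behead [tuple of behead w]]) ->
  recursive (fun v => nat_rect (fun=> nat) (A v) (fun k acc => B k acc v) (N v)).
Proof.
move=> cA cN cB; apply: recursive_ext (recursive_rec cA cB cN) => v.
by elim: (N v) => //= k ->; rewrite tnthS !tnth0 behead2_cons.
Qed.

Lemma recursive_add F G : recursive F -> recursive G ->
  recursive (fun v => F v + G v).
Proof.
move=> cF cG; apply: recursive_ext
  (recursive_iter (B := fun _ acc _ => acc.+1) cF cG _).
  by move=> v; elim: (G v) => [|k IHk] /=; rewrite ?addn0 // addnS IHk.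
by apply: recursive_succ; apply: recursive_proj.
Qed.

Lemma recursive_pred F : recursive F -> recursive (fun v => (F v).-1).
Proof.
move=> cF; apply: recursive_ext
  (recursive_iter (B := fun k _ _ => k) (recursive_const _ 0) cF
     (recursive_proj _)).
by move=> v; case: (F v).
Qed.

End Arithmetic.

Section Arithmetic2.
Variable n : nat.
Implicit Types (F G : n.-tuple nat -> nat).

Lemma recursive_sub F G : recursive F -> recursive G ->
  recursive (fun v => F v - G v).
Proof.
move=> cF cG; apply: recursive_ext
  (recursive_iter (B := fun _ acc _ => acc.-1) cF cG _).
  by move=> v; elim: (G v) => [|k IHk] /=; rewrite ?subn0 // subnS IHk.
by apply: recursive_pred; apply: recursive_proj.
Qed.

Lemma recursive_mul F G : recursive F -> recursive G ->
  recursive (fun v => F v * G v).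
Proof.
move=> cF cG; apply: recursive_ext
  (recursive_iter (B := fun _ acc v => acc + F v) (recursive_const _ 0) cG _).
  by move=> v; elim: (G v) => [|k IHk] /=; rewrite ?muln0 // mulnSr IHk.
by apply: recursive_add; [apply: recursive_proj | exact: recursive_behead2].
Qed.

Lemma recursive_exp2 F : recursive F -> recursive (fun v => 2 ^ F v).
Proof.
move=> cF; apply: recursive_ext
  (recursive_iter (B := fun _ acc v => acc + acc) (recursive_const _ 1) cF _).
  by move=> v; elim: (F v) => //= k IHk; rewrite expnS mul2n -addnn IHk.
by apply: recursive_add; apply: recursive_proj.
Qed.

Lemma recursive_leq F G : recursive F -> recursive G ->
  recursive (fun v => F v <= G v : nat).
Proof.
move=> cF cG; apply: recursive_ext
  (recursive_sub (recursive_const _ 1) (recursive_sub cF cG)) => v.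
by rewrite /leq; case: (F v - G v).
Qed.

End Arithmetic2.

Section Arithmetic3.
Variable n : nat.
Implicit Types (F G : n.-tuple nat -> nat).

Lemma recursive_mu1 F (P : nat -> n.-tuple nat -> nat) :
  recursive (fun w : n.+1.-tuple nat => P (thead w) [tuple of behead w]) ->
  (forall v, P (F v) v = 0) -> (forall v k, k < F v -> 0 < P k v) -> recursive F.
Proof.
have e k (v : n.-tuple nat) : [tuple of behead [tuple of k :: v]] = v.
  exact: val_inj.
move=> cP P0 Pn0; apply: recursive_mu cP _ _ => [v|v k lt_k].
  by rewrite theadE e.
by rewrite theadE e; apply/eqP; rewrite -lt0n Pn0.
Qed.

Lemma recursive_div F G : recursive F -> recursive G ->
  recursive (fun v => F v %/ G v).
Proof.
(* The quotient is the least k with F < (k + 1) G. The factor [G v] stops the search at 0 for a zero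
   divisor, in agreement with [divn0]. *)
move=> cF cG; apply: (@recursive_mu1 _ (fun k v => G v * ((F v).+1 - k.+1 * G v))).
- apply: recursive_mul; first exact: recursive_behead.
  apply: recursive_sub; first by apply: recursive_succ; apply: recursive_behead.
  apply: recursive_mul; last exact: recursive_behead.
  exact/recursive_succ/recursive_proj.
- move=> v; case: (posnP (G v)) => [->|G_gt0]; rewrite ?mul0n //.
  by apply/eqP; rewrite muln_eq0 subn_eq0 ltn_ceil ?orbT.
- move=> v k; case: (posnP (G v)) => [->|G_gt0]; first by rewrite divn0.
  by rewrite leq_divRL // => le; rewrite muln_gt0 G_gt0 subn_gt0 ltnS.
Qed.

Lemma recursive_mod F G : recursive F -> recursive G ->
  recursive (fun v => F v %% G v).
Proof.
move=> cF cG; apply: recursive_ext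
  (recursive_sub cF (recursive_mul (recursive_div cF cG) cG)) => v.
by rewrite {1}(divn_eq (F v) (G v)) addKn.
Qed.

End Arithmetic3.

(** * Lists as numbers: the exponent of 2 is the head, the odd part gives the tail *)

Definition ccons (x m : nat) : nat := 2 ^ x * m.*2.+1.
Definition chead (c : nat) : nat := head 0 (CodeSeq.decode c).
Definition ctail (c : nat) : nat := CodeSeq.code (behead (CodeSeq.decode c)).

Lemma code_cons x s : CodeSeq.code (x :: s) = ccons x (CodeSeq.code s).
Proof. by []. Qed.

Lemma ccons_head_tail c : 0 < c -> c = ccons (chead c) (ctail c).
Proof.
rewrite /chead /ctail -{1 2}[c]CodeSeq.decodeK.
by case: (CodeSeq.decode c).
Qed.

Lemma chead_cons x m : chead (ccons x m) = x.
Proof. by rewrite /chead -[m]CodeSeq.decodeK -code_cons CodeSeq.codeK. Qed.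

Lemma ctail_cons x m : ctail (ccons x m) = m.
Proof. by rewrite /ctail -[m]CodeSeq.decodeK -code_cons CodeSeq.codeK. Qed.

Lemma ccons_gt0 x m : 0 < ccons x m.
Proof. by rewrite muln_gt0 expn_gt0. Qed.

(** The head of a code is its 2-adic valuation; [recursive_head] finds it by these divisibility
    tests. *)
Lemma ccons_dvd x m k : (2 ^ k %| ccons x m) = (k <= x).
Proof.
rewrite /ccons; case: (leqP k x) => [le|lt].
  by apply: dvdn_mulr; exact: dvdn_exp2l.
apply/negbTE/negP => dv; have := dvdn_trans (dvdn_exp2l 2 lt) dv.
by rewrite expnS mulnC dvdn_pmul2l ?expn_gt0 // dvdn2 /= odd_double.
Qed.

Section ListCode.
Variable n : nat.
Implicit Types (F G : n.-tuple nat -> nat).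

Lemma recursive_cons F G : recursive F -> recursive G ->
  recursive (fun v => ccons (F v) (G v)).
Proof.
move=> cF cG; apply: recursive_mul; first exact: recursive_exp2.
by apply: recursive_ext (recursive_succ (recursive_add cG cG)) => v; rewrite addnn.
Qed.

Lemma recursive_head F : recursive F -> recursive (fun v => chead (F v)).
Proof.
move=> cF.
(* The head is the least k such that 2^(k+1) does not divide the code. The factor [F v] makes the
   code 0 of the empty list return 0, the default value in [chead]. *)
apply: (@recursive_mu1 _ _ (fun k v => F v * (1 - F v %% 2 ^ k.+1))).
- apply: recursive_mul; first exact: recursive_behead.
  apply: recursive_sub; first exact: recursive_const.
  apply: recursive_mod; first exact: recursive_behead.
  exact/recursive_exp2/recursive_succ/recursive_proj.
- move=> v; case: (posnP (F v)) => [->//|/ccons_head_tail ->].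
  rewrite chead_cons; set c := ccons _ _.
  suff: 0 < c %% 2 ^ (chead (F v)).+1 by case: (_ %% _) => // m _; rewrite muln0.
  by rewrite lt0n -/(dvdn _ _) ccons_dvd ltnn.
- move=> v k; case: (posnP (F v)) => [->//|/ccons_head_tail ->].
  rewrite chead_cons => lt_k; rewrite muln_gt0 ccons_gt0 /=.
  by have := ccons_dvd (chead (F v)) (ctail (F v)) k.+1; rewrite lt_k => /eqP ->.
Qed.

Lemma recursive_tail F : recursive F -> recursive (fun v => ctail (F v)).
Proof.
move=> cF; apply: recursive_ext (recursive_div (recursive_div cF (recursive_exp2
  (recursive_head cF)))
  (recursive_const _ 2)) => v.
case: (posnP (F v)) => [->//|/ccons_head_tail ->].
rewrite chead_cons ctail_cons /ccons mulKn ?expn_gt0 // divn2 /=.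
by rewrite uphalf_double.
Qed.

End ListCode.

Definition recursive1 (F : nat -> nat) : Prop :=
  recursive (fun v : 1.-tuple nat => F (thead v)).

Lemma recursive1_id : recursive1 id.
Proof. exact: recursive_proj. Qed.

Lemma recursive_comp1 n (F : nat -> nat) (G : n.-tuple nat -> nat) :
  recursive1 F -> recursive G -> recursive (fun v => F (G v)).
Proof.
move=> cF cG; apply: recursive_ext
  (recursive_comp (H := fun _ => G) cF (fun _ => cG)).
by move=> v; rewrite /thead tnth_mktuple.
Qed.

Lemma recursive1_comp F G : recursive1 F -> recursive1 G ->
  recursive1 (fun c => F (G c)).
Proof. by move=> cF cG; exact: (recursive_comp1 cF cG). Qed.

(** A pair is coded as a list of two elements, the format of [code_rat] and [code_term]. *)
Definition cpair (a b : nat) : nat := ccons a (ccons b 0).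

Lemma recursive1_rec A N H : recursive1 A -> recursive1 N -> recursive1 H ->
  recursive1 (fun c => nat_rect (fun=> nat) (A c)
           (fun k acc => H (cpair (cpair c k) acc)) (N c)).
Proof.
move=> cA cN cH; apply: recursive_ext
  (recursive_iter (B := fun k acc v => H (cpair (cpair (thead v) k) acc)) cA cN _).
  by [].
have hpair F G : recursive F -> recursive G ->
    recursive (fun v : 3.-tuple nat => cpair (F v) (G v)).
  by move=> cF cG; do 2?[apply: recursive_cons] => //; exact: recursive_const.
apply: recursive_comp1 => //; apply: (hpair); last exact: recursive_proj.
apply: hpair; last exact: recursive_proj.
exact: (recursive_behead2 (recursive_proj ord0)).
Qed.

Lemma recursive1_mu (F : nat -> nat) (P : nat -> nat -> nat) :
  recursive1 (fun c => P (chead (ctail c)) (chead c)) ->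
  (forall c, P (F c) c = 0) -> (forall c k, k < F c -> 0 < P k c) -> recursive1 F.
Proof.
move=> cP P0 Pn0; apply: (@recursive_mu1 _ _ (fun k v => P k (thead v))).
- apply: recursive_ext (recursive_comp1 (G := fun w : 2.-tuple nat =>
    cpair (thead [tuple of behead w]) (thead w)) cP _) => [w|].
    by rewrite /cpair ctail_cons !chead_cons.
  apply: recursive_cons; first exact: (recursive_behead (recursive_proj ord0)).
  by apply: recursive_cons; [exact: recursive_proj | exact: recursive_const].
- by move=> v; exact: P0.
- by move=> v k; exact: Pn0.
Qed.

(** * Computable functions on encoded types *)

(* [enc] need not be onto; [dec] is total, so that a search can run through all
   natural numbers. *)
Class Enc (T : Type) := { enc : T -> nat; dec : nat -> T; encK : cancel enc dec }.

#[refine] Instance Enc_nat : Enc nat := {| enc := id; dec := id |}.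
Proof. by []. Defined.

#[refine] Instance Enc_bool : Enc bool :=
  {| enc := nat_of_bool; dec n := 0 < n |}.
Proof. by case. Defined.

#[refine] Instance Enc_pair (T S : Type) (eT : Enc T) (eS : Enc S) :
    Enc (T * S) :=
  {| enc x := cpair (enc x.1) (enc x.2);
     dec n := (dec (chead n), dec (chead (ctail n))) |}.
Proof. by case=> x y /=; rewrite /cpair ctail_cons !chead_cons !encK. Defined.

#[refine] Instance Enc_seq (T : Type) (eT : Enc T) : Enc (seq T) :=
  {| enc s := CodeSeq.code (map enc s);
     dec n := map dec (CodeSeq.decode n) |}.
Proof. by move=> s; rewrite CodeSeq.codeK (mapK encK). Defined.

Definition computable {T S : Type} {eT : Enc T} {eS : Enc S} (f : T -> S) : Prop :=
  exists F, recursive1 F /\ forall x, F (enc x) = enc (f x).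

Section Combinators.
Context {X T S : Type} {eX : Enc X} {eT : Enc T} {eS : Enc S}.

Lemma cp_ext (f g : X -> T) : f =1 g -> computable f -> computable g.
Proof. by move=> e [F [cF hF]]; exists F; split=> // x; rewrite hF e. Qed.

Lemma cp_id : computable (fun x : X => x).
Proof. by exists id; split => //; exact: recursive1_id. Qed.

Lemma cp_const (c : T) : computable (fun _ : X => c).
Proof. by exists (fun _ => enc c); split => //; exact: recursive_const. Qed.

Lemma cp_comp (f : T -> S) (g : X -> T) :
  computable f -> computable g -> computable (fun x => f (g x)).
Proof.
move=> [F [cF hF]] [G [cG hG]]; exists (fun c => F (G c)).
by split=> [|x]; [exact: recursive1_comp | rewrite hG hF].
Qed.

Lemma cp_pair (f : X -> T) (g : X -> S) :
  computable f -> computable g -> computable (fun x => (f x, g x)).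
Proof.
move=> [F [cF hF]] [G [cG hG]]; exists (fun c => cpair (F c) (G c)).
split=> [|x]; last by rewrite hF hG.
by do 2?[apply: recursive_cons] => //; exact: recursive_const.
Qed.

Lemma cp_fst (f : X -> T * S) : computable f -> computable (fun x => (f x).1).
Proof.
move=> [F [cF hF]]; exists (fun c => chead (F c)); split=> [|x].
  exact: recursive_head.
by rewrite hF /= /cpair chead_cons.
Qed.

Lemma cp_snd (f : X -> T * S) : computable f -> computable (fun x => (f x).2).
Proof.
move=> [F [cF hF]]; exists (fun c => chead (ctail (F c))); split=> [|x].
  exact/recursive_head/recursive_tail.
by rewrite hF /= /cpair ctail_cons chead_cons.
Qed.

Lemma cp_cons (f : X -> T) (g : X -> seq T) :
  computable f -> computable g -> computable (fun x => f x :: g x).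
Proof.
move=> [F [cF hF]] [G [cG hG]]; exists (fun c => ccons (F c) (G c)).
by split=> [|x]; [exact: recursive_cons | rewrite hF hG].
Qed.

Lemma cp_behead (f : X -> seq T) :
  computable f -> computable (fun x => behead (f x)).
Proof.
move=> [F [cF hF]]; exists (fun c => ctail (F c)); split=> [|x].
  exact: recursive_tail.
by rewrite hF /=; case: (f x) => //= a s; rewrite ctail_cons.
Qed.

Lemma cp_if (b : X -> bool) (f g : X -> T) :
  computable b -> computable f -> computable g ->
  computable (fun x => if b x then f x else g x).
Proof.
move=> [B [cB hB]] [F [cF hF]] [G [cG hG]].
exists (fun c => B c * F c + (1 - B c) * G c); split=> [|x].
  apply: recursive_add; apply: recursive_mul => //.
  by apply: recursive_sub => //; exact: recursive_const.
by rewrite hB hF hG; case: (b x); rewrite /= ?mul1n ?mul0n ?addn0.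
Qed.

Lemma cp_head (x0 : T) (f : X -> seq T) :
  computable f -> computable (fun x => head x0 (f x)).
Proof.
move=> [F [cF hF]].
exists (fun c => (0 < F c) * chead (F c) + (F c == 0) * enc x0); split=> [|x].
  apply: recursive_add; apply: recursive_mul.
  - by apply: recursive_leq => //; exact: recursive_const.
  - exact: recursive_head.
  - by apply: recursive_ext (recursive_leq cF (recursive_const _ 0)) => v;
    rewrite leqn0.
  - exact: recursive_const.
rewrite hF /=; case: (f x) => [|a s] /=; first by rewrite mul1n.
by rewrite -/(ccons _ _) ccons_gt0 chead_cons gtn_eqF ?ccons_gt0 // mul1n addn0.
Qed.

Lemma cp_nilp (f : X -> seq T) : computable f -> computable (fun x => nilp (f x)).
Proof.
move=> [F [cF hF]]; exists (fun c => F c <= 0 : nat); split=> [|x].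
  by apply: recursive_leq => //; exact: recursive_const.
rewrite hF /=; case: (f x) => [|a s] //=.
by rewrite -/(ccons _ _) leqNgt ccons_gt0.
Qed.

Lemma cp_rec (a : X -> T) (n : X -> nat) (h : X -> nat -> T -> T) :
  computable a -> computable n ->
  computable (fun p : X * nat * T => h p.1.1 p.1.2 p.2) ->
  computable (fun x => nat_rect (fun=> T) (a x) (h x) (n x)).
Proof.
move=> [A [cA hA]] [N [cN hN]] [H [cH hH]].
exists (fun c => nat_rect (fun=> nat) (A c)
                   (fun k acc => H (cpair (cpair c k) acc)) (N c)).
split=> [|x]; first exact: recursive1_rec.
rewrite hN hA; change (enc (n x)) with (n x).
by elim: (n x) => //= k ->; rewrite -(hH (x, k, _)).
Qed.

(* The bound [b] makes the search terminate also on the numbers that encode no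
   element of [X]. *)
Lemma cp_bmu (f b : X -> nat) (P : X -> nat -> bool) :
  computable b -> computable (fun p : X * nat => P p.1 p.2) ->
  (forall x, f x <= b x) ->
  (forall x, P x (f x)) -> (forall x k, k < f x -> ~~ P x k) -> computable f.
Proof.
move=> [B [cB hB]] [Q [cQ hQ]] fb Pf Pnf.
pose G k c := (1 - Q (cpair c k)) * (B c - k).
have exG c : exists k, G k c == 0 by exists (B c); rewrite /G subnn muln0.
exists (fun c => ex_minn (exG c)); split=> [|x].
  apply: (@recursive1_mu _ G).
  - apply: recursive_mul; apply: recursive_sub.
    + exact: recursive_const.
    + apply: recursive_comp1 => //; apply: recursive_cons.
        exact/recursive_head/recursive_proj.
      apply: recursive_cons; last exact: recursive_const.
      exact/recursive_head/recursive_tail/recursive_proj.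
    + exact/(recursive_comp1 cB)/recursive_head/recursive_proj.
    + exact/recursive_head/recursive_tail/recursive_proj.
  - by move=> c; case: ex_minnP => k /eqP.
  - move=> c k; case: ex_minnP => m _ min_m; rewrite ltnNge lt0n.
    by apply: contra => /min_m.
have GE k : (G k (enc x) == 0) = P x k || (b x <= k).
  rewrite /G; change (cpair (enc x) k) with (enc (x, k));
    rewrite hQ hB /= muln_eq0 !subn_eq0.
  by case: (P x k).
case: ex_minnP => m; rewrite GE => Pm min_m; apply/eqP; rewrite eqn_leq.
have -> /= : m <= enc (f x) by apply: min_m; rewrite GE Pf.
rewrite leqNgt; apply/negP => lt_m.
case/orP: Pm => [|le_b]; first exact/negP/Pnf.
by have := leq_trans lt_m (leq_trans (fb x) le_b); rewrite ltnn.
Qed.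

End Combinators.

Section NatComp.
Context {X : Type} {eX : Enc X}.
Implicit Types (f g : X -> nat) (a b : X -> bool).

Lemma cp_nat2 (op : nat -> nat -> nat) f g :
  (forall n (F G : n.-tuple nat -> nat), recursive F -> recursive G ->
     recursive (fun v => op (F v) (G v))) ->
  computable f -> computable g -> computable (fun x => op (f x) (g x)).
Proof.
move=> cop [F [cF hF]] [G [cG hG]]; exists (fun c => op (F c) (G c)).
by split=> [|x]; [exact: cop | rewrite hF hG].
Qed.

Lemma cp_add f g : computable f -> computable g -> computable (fun x => f x + g x).
Proof. exact/cp_nat2/recursive_add. Qed.

Lemma cp_sub f g : computable f -> computable g -> computable (fun x => f x - g x).
Proof. exact/cp_nat2/recursive_sub. Qed.

Lemma cp_mul f g : computable f -> computable g -> computable (fun x => f x * g x).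
Proof. exact/cp_nat2/recursive_mul. Qed.

Lemma cp_div f g : computable f -> computable g -> computable (fun x => f x %/ g x).
Proof. exact/cp_nat2/recursive_div. Qed.

Lemma cp_mod f g : computable f -> computable g -> computable (fun x => f x %% g x).
Proof. exact/cp_nat2/recursive_mod. Qed.

Lemma cp_S f : computable f -> computable (fun x => (f x).+1).
Proof.
move=> cf; apply: cp_ext (cp_add cf (cp_const 1)) => x; exact: addn1.
Qed.

Lemma cp_pred f : computable f -> computable (fun x => (f x).-1).
Proof.
move=> cf; apply: cp_ext (cp_sub cf (cp_const 1)) => x; exact: subn1.
Qed.

Lemma cp_leq f g : computable f -> computable g -> computable (fun x => f x <= g x).
Proof.
move=> [F [cF hF]] [G [cG hG]]; exists (fun c => F c <= G c : nat).
by split=> [|x]; [exact: recursive_leq | rewrite hF hG].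
Qed.

Lemma cp_negb b : computable b -> computable (fun x => ~~ b x).
Proof.
move=> cb; apply: cp_ext (cp_if cb (cp_const false) (cp_const true)) => x.
by case: (b x).
Qed.

Lemma cp_andb a b :
  computable a -> computable b -> computable (fun x => a x && b x).
Proof.
by move=> ca cb; apply: cp_ext (cp_if ca cb (cp_const false)) => x; case: (a x).
Qed.

Lemma cp_orb a b :
  computable a -> computable b -> computable (fun x => a x || b x).
Proof.
by move=> ca cb; apply: cp_ext (cp_if ca (cp_const true) cb) => x; case: (a x).
Qed.

Lemma cp_enc (T : Type) (eT : Enc T) (f : X -> T) :
  computable f -> computable (fun x => enc (f x)).
Proof. by move=> [F [cF hF]]; exists F; split. Qed.

Lemma cp_eq (T : eqType) (eT : Enc T) (f g : X -> T) :
  computable f -> computable g -> computable (fun x => f x == g x).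
Proof.
move=> /cp_enc cf /cp_enc cg.
apply: cp_ext (cp_andb (cp_leq cf cg) (cp_leq cg cf)) => x.
by rewrite -eqn_leq (inj_eq (can_inj encK)).
Qed.

Lemma cp_gt0 f : computable f -> computable (fun x => 0 < f x).
Proof. by move=> cf; apply: cp_leq => //; apply: cp_const. Qed.

Lemma cp_odd f : computable f -> computable (fun x => odd (f x)).
Proof.
move=> cf; apply: cp_ext (cp_eq (cp_mod cf (cp_const 2)) (cp_const 1)) => x.
by rewrite modn2 eqb1.
Qed.

Lemma cp_half f : computable f -> computable (fun x => (f x)./2).
Proof.
by move=> cf; apply: cp_ext (cp_div cf (cp_const 2)) => x; rewrite divn2.
Qed.

Lemma cp_double f : computable f -> computable (fun x => (f x).*2).
Proof. by move=> cf; apply: cp_ext (cp_add cf cf) => x; rewrite addnn. Qed.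

End NatComp.

Section Comp2.
Context {X T1 T2 S : Type} {eX : Enc X} {e1 : Enc T1} {e2 : Enc T2} {eS : Enc S}.

Lemma cp_comp2 (h : T1 -> T2 -> S) (f : X -> T1) (g : X -> T2) :
  computable (fun p : T1 * T2 => h p.1 p.2) -> computable f -> computable g ->
  computable (fun x => h (f x) (g x)).
Proof.
by move=> ch cf cg; exact: (cp_comp (f := fun p => h p.1 p.2) ch (cp_pair cf cg)).
Qed.

End Comp2.

Section Lists.
Context {X T : Type} {eX : Enc X} {eT : Enc T}.
Implicit Types (s : X -> seq T) (n : X -> nat).

Lemma cp_drop n s : computable n -> computable s ->
  computable (fun x => drop (n x) (s x)).
Proof.
move=> cn cs; apply: cp_ext (cp_rec (h := fun _ _ => behead) cs cn _) => [x|].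
  elim: (n x) => [|k IHk] /=; rewrite ?drop0 // IHk.
  by rewrite -drop1 drop_drop add1n.
exact: (cp_behead (cp_snd cp_id)).
Qed.

Lemma cp_nth (x0 : T) s n :
  computable s -> computable n -> computable (fun x => nth x0 (s x) (n x)).
Proof.
move=> cs cn; apply: cp_ext (cp_head x0 (cp_drop cn cs)) => x.
by rewrite -nth0 nth_drop addn0.
Qed.

(** Every [ccons] exceeds its tail, so the code of a list is an a priori bound for the search of its
    length in [cp_size]. *)
Lemma size_enc (t : seq T) : size t <= enc t.
Proof.
elim: t => //= a t IHt; apply: leq_ltn_trans IHt _.
by apply: leq_trans (leq_pmull _ _); rewrite ?expn_gt0 //= ltnS -addnn leq_addr.
Qed.

End Lists.

Section Lists2.
Context {X T : Type} {eX : Enc X} {eT : Enc T}.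
Implicit Types (s : X -> seq T) (n : X -> nat).

Lemma cp_size s : computable s -> computable (fun x => size (s x)).
Proof.
move=> cs; apply: (@cp_bmu _ _ _ (fun x => enc (s x))
  (fun x k => nilp (drop k (s x)))).
- exact: cp_enc.
- apply: cp_nilp; apply: cp_drop; first exact: (cp_snd cp_id).
  exact: (cp_comp cs (cp_fst cp_id)).
- by move=> x; exact: size_enc.
- by move=> x; rewrite drop_size.
- by move=> x k lt_k; rewrite /nilp size_drop subn_eq0 -ltnNge.
Qed.

Lemma cp_mkseq (F : X -> nat -> T) n :
  computable (fun p : X * nat => F p.1 p.2) -> computable n ->
  computable (fun x => mkseq (F x) (n x)).
Proof.
(* Lists grow at the front, so step k of the recursion adds the entry of index [n x - k.+1]. *)
move=> cF cn; apply: cp_ext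
  (cp_rec (h := fun x k acc => F x (n x - k.+1) :: acc) (cp_const [::]) cn _).
  move=> x; set s := nat_rect _ _ _.
  suff H k : k <= n x -> s k = map (F x) (iota (n x - k) k) by rewrite H ?subnn.
  elim: k => //= k IHk lt_k; rewrite /= IHk ?(ltnW lt_k) // -subSn //.
apply: cp_cons; last exact: (cp_snd cp_id).
apply: (cp_comp2 (h := F) cF); first exact: (cp_fst (cp_fst cp_id)).
apply: cp_sub; first exact: (cp_comp cn (cp_fst (cp_fst cp_id))).
exact: cp_S (cp_snd (cp_fst cp_id)).
Qed.

Lemma cp_bigop (idx : T) (op : Monoid.law idx) n (F : X -> nat -> T) :
  computable (fun p : T * T => op p.1 p.2) -> computable n ->
  computable (fun p : X * nat => F p.1 p.2) ->
  computable (fun x => \big[op/idx]_(i < n x) F x i).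
Proof.
move=> cop cn cF; apply: cp_ext
  (cp_rec (h := fun x k acc => op acc (F x k)) (cp_const idx) cn _).
  by move=> x; elim: (n x) => [|k IHk]; rewrite ?big_ord0 // big_ord_recr /= IHk.
apply: (cp_comp2 (h := op) cop); first exact: (cp_snd cp_id).
apply: (cp_comp2 (h := F) cF); first exact: (cp_fst (cp_fst cp_id)).
exact: (cp_snd (cp_fst cp_id)).
Qed.


End Lists2.

Section BigBool.
Context {X : Type} {eX : Enc X}.

Lemma cp_forall (n : X -> nat) (P : X -> nat -> bool) : computable n ->
  computable (fun p : X * nat => P p.1 p.2) ->
  computable (fun x => [forall i : 'I_(n x), P x i]).
Proof.
move=> cn cP; apply: cp_ext (cp_bigop (op := andb) _ cn cP).
  by move=> x; rewrite big_andE.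
by apply: cp_andb; [exact: cp_fst cp_id | exact: cp_snd cp_id].
Qed.

Lemma cp_sumn (n : X -> nat) (F : X -> nat -> nat) : computable n ->
  computable (fun p : X * nat => F p.1 p.2) ->
  computable (fun x => \sum_(i < n x) F x i).
Proof.
move=> cn; apply: (cp_bigop (op := addn)) => //.
by apply: cp_add; [exact: cp_fst cp_id | exact: cp_snd cp_id].
Qed.

Lemma cp_expn (f g : X -> nat) :
  computable f -> computable g -> computable (fun x => f x ^ g x).
Proof.
move=> cf cg; apply: cp_ext
  (cp_rec (h := fun x _ acc => f x * acc) (cp_const 1) cg _).
  by move=> x; elim: (g x) => //= k ->; rewrite expnS.
by apply: cp_mul; [exact: (cp_comp cf (cp_fst (cp_fst cp_id)))
                 | exact: cp_snd cp_id].
Qed.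

End BigBool.

(** An extension point of [cp], redefined once rational arithmetic and coefficient lists are known
    to be computable. *)
Ltac cp_hook := fail.

Ltac cp :=
  cbv beta; first [assumption |
  lazymatch goal with
  | |- computable (fun x => x) => exact cp_id
  | |- computable (fun x => fst _) => apply: cp_fst; cp
  | |- computable (fun x => snd _) => apply: cp_snd; cp
  | |- computable (fun x => pair _ _) => apply: cp_pair; cp
  | |- computable (fun x => cons _ _) => apply: cp_cons; cp
  | |- computable (fun x => if _ then _ else _) => apply: cp_if; cp
  | |- computable (fun x => behead _) => apply: cp_behead; cp
  | |- computable (fun x => nth _ _ _) => apply: cp_nth; cp
  | |- computable (fun x => head _ _) => apply: cp_head; cp
  | |- computable (fun x => nilp _) => apply: cp_nilp; cp
  | |- computable (fun x => size _) => apply: cp_size; cp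
  | |- computable (fun x => mkseq (fun i => _) _) => apply: cp_mkseq; cp
  | |- computable (fun x => S _) => apply: cp_S; cp
  | |- computable (fun x => predn _) => apply: cp_pred; cp
  | |- computable (fun x => addn _ _) => apply: cp_add; cp
  | |- computable (fun x => subn _ _) => apply: cp_sub; cp
  | |- computable (fun x => muln _ _) => apply: cp_mul; cp
  | |- computable (fun x => divn _ _) => apply: cp_div; cp
  | |- computable (fun x => modn _ _) => apply: cp_mod; cp
  | |- computable (fun x => expn _ _) => apply: cp_expn; cp
  | |- computable (fun x => double _) => apply: cp_double; cp
  | |- computable (fun x => half _) => apply: cp_half; cp
  | |- computable (fun x => odd _) => apply: cp_odd; cp
  | |- computable (fun x => negb _) => apply: cp_negb; cp
  | |- computable (fun x => andb _ _) => apply: cp_andb; cp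
  | |- computable (fun x => orb _ _) => apply: cp_orb; cp
  | |- computable (fun x => leq _ _) => apply: cp_leq; cp
  | |- computable (fun x => eq_op _ _) => apply: cp_eq; cp
  | |- _ => first [exact: cp_const
      | match goal with H : computable ?f |- computable (fun x => ?f _) =>
          apply: (cp_comp H); cp end
      | exact: (cp_fst cp_id) | exact: (cp_snd cp_id)
      | exact: (cp_odd cp_id) | exact: (cp_half cp_id) | exact: (cp_S cp_id)
      | exact: (cp_size cp_id) | exact: (cp_behead cp_id) | cp_hook | idtac]
  end].

(** * Computable arithmetic *)

#[refine] Instance Enc_int : Enc int :=
  {| enc := code_int; dec n := if odd n then Negz n./2 else Posz n./2 |}.
Proof. by case=> n /=; rewrite odd_double /= ?uphalf_double ?doubleK. Defined.

#[refine] Instance Enc_rat : Enc rat :=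
  {| enc := code_rat;
     dec n := ((dec (chead n) : int)%:~R / (dec (chead (ctail n)) : int)%:~R)%R |}.
Proof.
move=> r; rewrite /code_rat !code_cons ctail_cons !chead_cons.
by rewrite -!/(@enc int _ _) !encK divq_num_den.
Defined.

(** As differences of naturals, integers are added and multiplied without case analysis on signs. *)
Definition int_diff (p m : nat) : int := (p%:Z - m%:Z)%R.
Definition int_pos (z : int) : nat := if z is Posz n then n else 0.
Definition int_neg (z : int) : nat := if z is Negz n then n.+1 else 0.

Lemma int_diffE z : z = int_diff (int_pos z) (int_neg z).
Proof. by case: z => n; rewrite /int_diff /= ?subr0 // sub0r NegzE. Qed.

Section IntComp.
Context {X : Type} {eX : Enc X}.
Implicit Types (f g : X -> int) (p m : X -> nat).

Lemma cp_via (T S : Type) (eT : Enc T) (eS : Enc S) (f : X -> T)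
    (h : T -> S) (H : nat -> S) :
  (forall t, h t = H (enc t)) -> computable H -> computable f ->
    computable (fun x => h (f x)).
Proof.
move=> hE cH cf; have := cp_comp cH (cp_enc cf).
by apply: cp_ext => x; rewrite hE.
Qed.

Lemma cp_enc_inv (T : Type) (eT : Enc T) (f : X -> T) :
  computable (fun x => enc (f x)) -> computable f.
Proof. by move=> [F [cF hF]]; exists F; split. Qed.

Lemma cp_int_pos f : computable f -> computable (fun x => int_pos (f x)).
Proof.
apply: (cp_via (H := fun n => if odd n then 0 else n./2)); last by cp.
by case=> n /=; rewrite odd_double /= ?doubleK.
Qed.

Lemma cp_int_neg f : computable f -> computable (fun x => int_neg (f x)).
Proof.
apply: (cp_via (H := fun n => if odd n then n./2.+1 else 0)); last by cp.
by case=> n /=; rewrite odd_double /= ?uphalf_double.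
Qed.

Lemma cp_int_diff p m : computable p -> computable m ->
  computable (fun x => int_diff (p x) (m x)).
Proof.
move=> cp' cm; apply: cp_enc_inv.
apply: (@cp_ext _ _ _ _ (fun x => if m x <= p x then (p x - m x).*2
                          else (m x - p x - 1).*2.+1)); last by cp.
move=> x; case: leqP => [le|lt]; rewrite /int_diff.
  by rewrite subzn.
rewrite -opprB subzn ?(ltnW lt) //.
by move: lt; rewrite -subn_gt0; case: (_ - _) => // k _; rewrite subn1.
Qed.

End IntComp.

Section IntComp2.
Context {X : Type} {eX : Enc X}.
Implicit Types (f g : X -> int) (p m : X -> nat).

Lemma cp_intD f g : computable f -> computable g ->
  computable (fun x => f x + g x)%R.
Proof.
move=> cf cg.
have cf1 := cp_int_pos cf; have cf2 := cp_int_neg cf.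
have cg1 := cp_int_pos cg; have cg2 := cp_int_neg cg.
apply: cp_ext (cp_int_diff (cp_add cf1 cg1) (cp_add cf2 cg2)) => x.
rewrite [f x in RHS]int_diffE [g x in RHS]int_diffE /int_diff !PoszD; ring.
Qed.

Lemma cp_intM f g : computable f -> computable g ->
  computable (fun x => f x * g x)%R.
Proof.
move=> cf cg.
have cf1 := cp_int_pos cf; have cf2 := cp_int_neg cf.
have cg1 := cp_int_pos cg; have cg2 := cp_int_neg cg.
apply: cp_ext (cp_int_diff (cp_add (cp_mul cf1 cg1) (cp_mul cf2 cg2))
                           (cp_add (cp_mul cf1 cg2) (cp_mul cf2 cg1))) => x.
rewrite [f x in RHS]int_diffE [g x in RHS]int_diffE /int_diff !PoszD !PoszM; ring.
Qed.

Lemma cp_absz f : computable f -> computable (fun x => absz (f x)).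
Proof.
move=> cf; apply: cp_ext (cp_add (cp_int_neg cf) (cp_int_pos cf)) => x.
by case: (f x) => n; rewrite /= ?addn0.
Qed.

Lemma cp_int_gt0 f : computable f -> computable (fun x => 0 < f x)%R.
Proof.
move=> cf; apply: cp_ext (cp_gt0 (cp_int_pos cf)) => x.
by case: (f x).
Qed.

Lemma cp_numq (f : X -> rat) : computable f -> computable (fun x => numq (f x)).
Proof.
move=> cf; apply: cp_enc_inv.
apply: (cp_via (h := fun r : rat => enc (numq r)) (H := chead)) cf => [r|].
  by rewrite /= /code_rat code_cons chead_cons.
by exists chead; split => //; exact/recursive_head/recursive_proj.
Qed.

Lemma cp_denq (f : X -> rat) : computable f -> computable (fun x => denq (f x)).
Proof.
move=> cf; apply: cp_enc_inv.
apply: (cp_via (h := fun r : rat => enc (denq r)) (H := fun c =>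
  chead (ctail c))) cf => [r|].
  by rewrite /= /code_rat !code_cons ctail_cons chead_cons.
by exists (fun c => chead (ctail c)); split => //;
  exact/recursive_head/recursive_tail/recursive_proj.
Qed.

End IntComp2.

(* [n %/ gcdn a n] is the least [y > 0] such that [n] divides [a * y]. *)
Lemma cp_reduced_den (X : Type) (eX : Enc X) (a n : X -> nat) :
  computable a -> computable n ->
  computable (fun x => if n x == 0 then 1 else n x %/ gcdn (a x) (n x)).
Proof.
move=> ca cn; apply: (@cp_bmu _ _ _ (fun x => (n x).+1)
  (fun x y => (0 < y) && ((n x == 0) || ((a x * y) %% n x == 0)))).
- by cp.
- by cp.
- by move=> x; case: posnP => // n_gt0; rewrite ltnW // ltnS leq_div.
- move=> x; case: (posnP (n x)) => [|n_gt0] /=; rewrite ?orbT //.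
  rewrite divn_gt0 ?gcdn_gt0 ?n_gt0 ?orbT // dvdn_leq ?dvdn_gcdr //=.
  by rewrite muln_divCA_gcd; exact: dvdn_mulr.
- move=> x y; case: (posnP (n x)) => [|n_gt0] lt_y /=; first by case: y lt_y.
  apply/negP => /andP[y_gt0 dv]; have g_gt0: 0 < gcdn (a x) (n x) by rewrite
    gcdn_gt0 n_gt0 orbT.
  suff : n x %/ gcdn (a x) (n x) %| y by move/(dvdn_leq y_gt0); rewrite leqNgt lt_y.
  rewrite -(@Gauss_dvdr _ (a x %/ gcdn (a x) (n x))); last first.
    rewrite /coprime -(eqn_pmul2r g_gt0) muln_gcdl !divnK ?dvdn_gcdl ?dvdn_gcdr //.
    by rewrite gcdnC mul1n.
  rewrite -(dvdn_pmul2r g_gt0) mulnAC !divnK ?dvdn_gcdl ?dvdn_gcdr //.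
Qed.

Definition mkq (z : int) (n : nat) : rat := (z%:~R / n%:R)%R.

(** The code of a rational is that of its reduced fraction, so numerator and denominator are divided
    by their gcd. For a zero denominator the result is 0, coded as 0 / 1. *)
Lemma cp_mkq (X : Type) (eX : Enc X) (f : X -> int) (n : X -> nat) :
  computable f -> computable n -> computable (fun x => mkq (f x) (n x)).
Proof.
move=> cf cn.
have cD := cp_reduced_den (cp_absz cf) cn.
have cp1 := cp_int_pos cf; have cm1 := cp_int_neg cf.
have cG := cp_div cn cD.
have cN : computable (fun x => if n x == 0 then 0%R else
  int_diff (int_pos (f x) %/ (n x %/ (if n x == 0 then 1 else n x %/ gcdn `|f x|
    (n x))))
  (int_neg (f x) %/ (n x %/ (if n x == 0 then 1 else n x %/ gcdn `|f x| (n x))))).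
  apply: cp_if; [by cp | by cp | apply: cp_int_diff; by apply: cp_div].
have cP := cp_pair cN (cp_int_diff cD (cp_const 0)).
apply: cp_enc_inv; apply: cp_ext (cp_enc cP) => x.
rewrite -[enc (_, _)]/(cpair (code_int _) (code_int _)).
rewrite -[enc (mkq _ _)]/(cpair (code_int _) (code_int _)).
rewrite [int_diff _ 0]subr0 /mkq.
case: (posnP (n x)) => [->|n_gt0]; first by rewrite invr0 mulr0.
set g := gcdn _ _; have g_gt0 : 0 < g by rewrite gcdn_gt0 n_gt0 orbT.
have dvg : g %| n x by exact: dvdn_gcdr.
have -> : n x %/ (n x %/ g) = g by rewrite divnA // mulKn.
set z := int_diff _ _.
have zE : f x = (z * Posz g)%R.
  rewrite /z; have : g %| `|f x| by exact: dvdn_gcdl.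
  case: (f x) => k; rewrite /int_diff /= ?div0n ?subr0 ?sub0r => dv.
    by rewrite -PoszM divnK.
  by rewrite mulNr -PoszM divnK // NegzE.
have cop : coprime `|z| `|Posz (n x %/ g)|.
  rewrite /coprime -(eqn_pmul2r g_gt0) muln_gcdl mul1n absz_nat divnK //.
  by rewrite -[X in gcdn (_ * X) _](absz_nat g) -abszM -zE.
have -> : ((f x)%:~R / (n x)%:R : rat)%R = (z%:~R / (Posz (n x %/ g)%N)%:~R)%R.
  rewrite zE intrM -[in LHS](divnK dvg) natrM -!pmulrn.
  have g0 : (g%:R : rat)%R != 0%R by rewrite pnatr_eq0 -lt0n.
  have d0 : ((n x %/ g)%:R : rat)%R != 0%R.
    by rewrite pnatr_eq0 -lt0n divn_gt0 // dvdn_leq.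
  by field; apply/andP; split.
have d_gt0 : 0 < n x %/ g by rewrite divn_gt0 // dvdn_leq.
by rewrite coprimeq_num // coprimeq_den // gtr0_sg // mul1r; case: (_ %/ _) d_gt0.
Qed.

Lemma mkqE (r : rat) : r = mkq (numq r) `|denq r|.
Proof.
by rewrite /mkq -[LHS]divq_num_den pmulrn absz_denq.
Qed.

Section RatComp.
Context {X : Type} {eX : Enc X}.
Implicit Types (f g : X -> rat).
Local Open Scope ring_scope.

Let den_neq0 (r : rat) : (`|denq r|%:R : rat) != 0.
Proof. by rewrite pnatr_eq0 absz_eq0 denq_eq0. Qed.

Lemma cp_ratD f g : computable f -> computable g -> computable (fun x => f x + g x).
Proof.
move=> cf cg; have nf := cp_numq cf; have ng := cp_numq cg.
have df := cp_absz (cp_denq cf); have dg := cp_absz (cp_denq cg).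
have dfz := cp_denq cf; have dgz := cp_denq cg.
apply: cp_ext (cp_mkq (cp_intD (cp_intM nf dgz) (cp_intM ng dfz)) (cp_mul df dg))
  => x.
rewrite [f x in RHS]mkqE [g x in RHS]mkqE /mkq !(intrD, intrM) natrM.
rewrite -[denq (g x)]absz_denq -[denq (f x)]absz_denq /= -!pmulrn.
by field; apply/andP; split; apply: den_neq0.
Qed.

Lemma cp_ratM f g : computable f -> computable g -> computable (fun x => f x * g x).
Proof.
move=> cf cg; have nf := cp_numq cf; have ng := cp_numq cg.
have df := cp_absz (cp_denq cf); have dg := cp_absz (cp_denq cg).
apply: cp_ext (cp_mkq (cp_intM nf ng) (cp_mul df dg)) => x.
rewrite [f x in RHS]mkqE [g x in RHS]mkqE /mkq !(intrD, intrM) natrM.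
by field; apply/andP; split; apply: den_neq0.
Qed.

Lemma cp_ratN f : computable f -> computable (fun x => - f x).
Proof.
move=> cf; apply: cp_ext (cp_ratM (cp_const (-1)) cf) => x; exact: mulN1r.
Qed.

Lemma cp_rat_gt0 f : computable f -> computable (fun x => 0 < f x).
Proof.
move=> cf; apply: cp_ext (cp_int_gt0 (cp_numq cf)) => x; exact: numq_gt0.
Qed.

Lemma cp_rat_nat (n : X -> nat) : computable n ->
  computable (fun x => (n x)%:R : rat).
Proof.
move=> cn; apply: cp_ext (cp_mkq (cp_int_diff cn (cp_const 0)) (cp_const 1)) => x.
by rewrite /mkq /int_diff subr0 divr1 -pmulrn.
Qed.

Lemma cp_normr f : computable f -> computable (fun x => `|f x|).
Proof.
move=> cf; apply: cp_ext (cp_if (cp_rat_gt0 cf) cf (cp_ratN cf)) => x.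
by case: ltrP => [/gtr0_norm ->|/ler0_norm ->].
Qed.

Lemma cp_rat_lt f g : computable f -> computable g ->
  computable (fun x => f x < g x).
Proof.
move=> cf cg; apply: cp_ext (cp_rat_gt0 (cp_ratD cg (cp_ratN cf))) => x.
by rewrite subr_gt0.
Qed.

End RatComp.

Section RatComp2.
Context {X : Type} {eX : Enc X}.
Local Open Scope ring_scope.

Lemma cp_rat_sum (n : X -> nat) (F : X -> nat -> rat) : computable n ->
  computable (fun p : X * nat => F p.1 p.2) ->
  computable (fun x => \sum_(i < n x) F x i).
Proof.
move=> cn cF; apply: (cp_bigop (op := @GRing.add rat) _ cn cF).
by apply: cp_ratD; cp.
Qed.

Lemma cp_rat_prod (n : X -> nat) (F : X -> nat -> rat) : computable n ->
  computable (fun p : X * nat => F p.1 p.2) ->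
  computable (fun x => \prod_(i < n x) F x i).
Proof.
move=> cn cF; apply: (cp_bigop (op := @GRing.mul rat) _ cn cF).
by apply: cp_ratM; cp.
Qed.

Lemma cp_rat_exp (f : X -> rat) (n : X -> nat) : computable f -> computable n ->
  computable (fun x => f x ^+ n x).
Proof.
move=> cf cn; have := cp_rat_prod (F := fun x _ =>
  f x) cn (cp_comp cf (cp_fst cp_id)).
by apply: cp_ext => x; rewrite prodr_const card_ord.
Qed.

End RatComp2.

#[refine] Instance Enc_poly : Enc {poly rat} :=
  {| enc p := enc (polyseq p); dec n := Poly (dec n) |}.
Proof. by move=> p; rewrite encK polyseqK. Defined.

Section PolyComp.
Context {X : Type} {eX : Enc X}.
Local Open Scope ring_scope.
Implicit Types (p q : X -> {poly rat}) (n : X -> nat).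

Lemma cp_polyseq p : computable p -> computable (fun x => polyseq (p x)).
Proof. by move=> [F [cF hF]]; exists F; split. Qed.

(** The code of a polynomial is that of its normalized coefficient list, so trailing zeros have to
    be cut off; the length to keep is found by a bounded search. *)
Lemma cp_Poly (s : X -> seq rat) : computable s -> computable (fun x => Poly (s x)).
Proof.
move=> cs.
have csz : computable (fun x => size (Poly (s x))).
  apply: (@cp_bmu _ _ _ (fun x => size (s x)) (fun x k =>
    [forall i : 'I_(size (s x)), ~~ (k <= i)%N || ((s x)`_i == 0)])).
  - by cp.
  - apply: (@cp_forall _ _ (fun y : X * nat => size (s y.1))
      (fun y i => ~~ (y.2 <= i)%N || ((s y.1)`_i == 0))); by cp.
  - by move=> x; exact: size_Poly.
  - move=> x; apply/forallP => i; rewrite -implybE; apply/implyP => le.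
    by rewrite -coef_Poly nth_default.
  - move=> x k lt_k; apply/negP => /forallP H.
    suff : (size (Poly (s x)) <= k)%N by rewrite leqNgt lt_k.
    apply/leq_sizeP => i le_ki; rewrite coef_Poly.
    case: (ltnP i (size (s x))) => [lt_i|]; last exact: nth_default.
    by have := H (Ordinal lt_i); rewrite /= le_ki => /eqP.
have : computable (fun x => mkseq (fun i => (s x)`_i) (size (Poly (s x)))).
  by apply: cp_mkseq; cp.
move=> [F [cF hF]]; exists F; split=> // x; rewrite hF.
congr CodeSeq.code; congr map; apply: (@eq_from_nth _ 0); rewrite size_mkseq //.
by move=> i lt_i; rewrite nth_mkseq // coef_Poly.
Qed.

Lemma cp_poly n (E : X -> nat -> rat) : computable n ->
  computable (fun y : X * nat => E y.1 y.2) ->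
  computable (fun x => \poly_(i < n x) E x i).
Proof.
move=> cn cE; apply: cp_ext (cp_Poly (cp_mkseq cE cn)) => x.
apply/polyP => i; rewrite coef_poly coef_Poly; case: ltnP => [lt|le].
  by rewrite nth_mkseq.
by rewrite nth_default // size_mkseq.
Qed.

End PolyComp.

Ltac cp_hook ::=
  lazymatch goal with
  | |- computable (fun x => polyseq _) => apply: cp_polyseq; cp
  | |- computable (fun x => GRing.mul (_ : rat) _) => apply: cp_ratM; cp
  | |- computable (fun x => GRing.add (_ : rat) _) => apply: cp_ratD; cp
  | |- computable (fun x => GRing.natmul 1%R _ : rat) => apply: cp_rat_nat; cp
  | |- computable (fun x => GRing.exp (_ : rat) _) => apply: cp_rat_exp; cp
  | |- computable (fun x => Num.norm (_ : rat)) => apply: cp_normr; cp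
  | |- computable (fun x => Order.lt (_ : rat) _) => apply: cp_rat_lt; cp
  end.

Section PolyComp2.
Context {X : Type} {eX : Enc X}.
Local Open Scope ring_scope.
Implicit Types (p q : X -> {poly rat}) (n : X -> nat).

Lemma cp_polyM p q : computable p -> computable q ->
  computable (fun x => p x * q x).
Proof.
move=> cp' cq.
apply: (@cp_ext _ _ _ _ (fun x => \poly_(i < size (p x) + size (q x))
  \sum_(j < i.+1) (p x)`_j * (q x)`_(i - j))) => [x|].
  apply/polyP => i; rewrite coef_poly coefM; case: ltnP => // le.
  rewrite -coefM nth_default // (leq_trans (size_polyMleq _ _)) //.
  by rewrite (leq_trans (leq_pred _)).
apply: cp_poly; first by cp.
apply: (@cp_rat_sum _ _ (fun y : X * nat => y.2.+1)
  (fun y j => (p y.1)`_j * (q y.1)`_(y.2 - j))); by cp.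
Qed.

Lemma cp_deriv p : computable p -> computable (fun x => (p x)^`()).
Proof.
move=> cp'.
apply: (@cp_ext _ _ _ _ (fun x => \poly_(i < size (p x))
  ((p x)`_i.+1 * i.+1%:R))) => [x|].
  apply/polyP => i; rewrite coef_poly coef_deriv mulr_natr; case: ltnP => // le.
  by rewrite nth_default ?mul0rn // ltnW.
apply: cp_poly; first by cp.
by cp.
Qed.

End PolyComp2.

Section PolyComp3.
Context {X : Type} {eX : Enc X}.
Local Open Scope ring_scope.

Lemma cp_polyX (p : X -> {poly rat}) (n : X -> nat) :
  computable p -> computable n -> computable (fun x => p x ^+ n x).
Proof.
move=> cp' cn; apply: cp_ext
  (cp_rec (h := fun x _ acc => p x * acc) (cp_const 1) cn _).
  by move=> x; elim: (n x) => //= k ->; rewrite exprS.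
by apply: cp_polyM; cp.
Qed.

End PolyComp3.

(** * Computable decoding *)

Section Decoding.
Local Open Scope ring_scope.

Lemma cp_chead : computable chead.
Proof. by exists chead; split => //; exact/recursive_head/recursive_proj. Qed.

Lemma cp_ctail : computable ctail.
Proof. by exists ctail; split => //; exact/recursive_tail/recursive_proj. Qed.

Lemma cp_dec_pair (T S : Type) (eT : Enc T) (eS : Enc S) :
  computable (dec : nat -> T) -> computable (dec : nat -> S) ->
  computable (dec : nat -> T * S).
Proof.
move=> cT cS; apply: cp_pair.
  exact: (cp_comp cT cp_chead).
exact: (cp_comp cS (cp_comp cp_chead cp_ctail)).
Qed.

Lemma cp_dec_seq (T : Type) (eT : Enc T) :
  computable (dec : nat -> T) -> computable (dec : nat -> seq T).
Proof.
(* Naturals encode themselves, so the code of [CodeSeq.decode c] is [c] again and the identity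
   realizes this function. *)
move=> cT; have cD : computable CodeSeq.decode.
  exists id; split=> [|c /=]; first exact: recursive_proj.
  by rewrite map_id CodeSeq.decodeK.
apply: (@cp_ext nat (seq T) _ _ (fun n => mkseq
  (fun i => dec (nth 0%N (CodeSeq.decode n) i)) (size (CodeSeq.decode n)))) => [n|].
  by rewrite /= -[in RHS](mkseq_nth 0%N (CodeSeq.decode n)) /mkseq -map_comp.
by apply: cp_mkseq; cp.
Qed.

Lemma cp_dec_int : computable (dec : nat -> int).
Proof.
apply: (@cp_ext nat int _ _ (fun n => if odd n then int_diff 0 n./2.+1 else
  int_diff n./2 0)).
  by move=> n; rewrite /int_diff /= sub0r subr0 NegzE.
by apply: cp_if; [cp | apply: cp_int_diff; cp | apply: cp_int_diff; cp].
Qed.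

Lemma cp_dec_rat : computable (dec : nat -> rat).
Proof.
have c1 := cp_comp cp_dec_int cp_chead.
have c2 := cp_comp cp_dec_int (cp_comp cp_chead cp_ctail).
(* On an arbitrary number the decoded denominator b may be negative or 0, whereas [mkq] takes a
   natural: a / b is computed as ab / |b|^2. *)
apply: cp_ext (cp_mkq (cp_intM c1 c2) (cp_mul (cp_absz c2) (cp_absz c2))) => n.
rewrite /mkq /=; set a := (if _ then _ else _); set b := (if _ then _ else _).
have [->|b0] := eqVneq b 0; first by rewrite mulr0 mul0r invr0 mulr0.
have -> : (`|b| * `|b|)%N%:R = b%:~R * b%:~R :> rat.
  by rewrite pmulrn PoszM !abszE -expr2 real_normK ?num_real // expr2 intrM.
have b0' : b%:~R != 0 :> rat by rewrite intr_eq0.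
by rewrite intrM; field.
Qed.

Lemma cp_dec_poly : computable (dec : nat -> {poly rat}).
Proof. exact: cp_Poly (cp_dec_seq cp_dec_rat). Qed.

End Decoding.

Local Open Scope ring_scope.

(** * Linear recurrent sequences *)

(** This is p(E) u at n, where E is the shift; by [actM], sequences form a module over
    polynomials. *)
Definition act (F : comNzRingType) (p : {poly F}) (u : nat -> F) (n : nat) : F :=
  \sum_(i < size p) p`_i * u (n + i)%N.

Section Act.
Variable F : comNzRingType.
Implicit Types (p q : {poly F}) (u v : nat -> F).

Lemma act_widen k p u n : (size p <= k)%N ->
  act p u n = \sum_(i < k) p`_i * u (n + i)%N.
Proof.
move=> le_pk; rewrite /act (big_ord_widen _ (fun i => p`_i * u (n + i)%N) le_pk).
rewrite big_mkcond; apply: eq_bigr => i _; case: ltnP => // le_i.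
by rewrite nth_default // mul0r.
Qed.

Lemma actD p q u n : act (p + q) u n = act p u n + act q u n.
Proof.
pose k := maxn (size p) (size q).
rewrite !(@act_widen k) ?leq_maxl ?leq_maxr ?size_polyD // -big_split.
by apply: eq_bigr => i _; rewrite coefD mulrDl.
Qed.

Lemma actZ a p u n : act (a *: p) u n = a * act p u n.
Proof.
rewrite !(@act_widen (size p)) ?size_scale_leq // mulr_sumr.
by apply: eq_bigr => i _; rewrite coefZ mulrA.
Qed.

Lemma act0 u n : act 0 u n = 0.
Proof. by rewrite /act size_poly0 big_ord0. Qed.

Lemma actN p u n : act (- p) u n = - act p u n.
Proof. by rewrite -scaleN1r actZ mulN1r. Qed.

Lemma actB p q u n : act (p - q) u n = act p u n - act q u n.
Proof. by rewrite actD actN. Qed.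

Lemma actC a u n : act a%:P u n = a * u n.
Proof.
by rewrite (@act_widen 1) ?size_polyC_leq1 // big_ord1 coefC addn0.
Qed.

Lemma act1 u n : act 1 u n = u n.
Proof. by rewrite -(mul1r (u n)) -actC. Qed.

Lemma actMX p u n : act (p * 'X) u n = act p u n.+1.
Proof.
rewrite (@act_widen (size p).+1); last by rewrite (leq_trans (size_polyMleq _ _))
  // size_polyX addn2.
rewrite big_ord_recl coefMX /= mul0r add0r; apply: eq_bigr => i _.
by rewrite coefMX /= addSnnS.
Qed.

Lemma eq_act p u v n : u =1 v -> act p u n = act p v n.
Proof. by move=> e; apply: eq_bigr => i _; rewrite e. Qed.

Lemma actM p q u n : act (p * q) u n = act p (act q u) n.
Proof.
elim/poly_ind: p n => [|p c IHp] n; first by rewrite mul0r !act0.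
by rewrite mulrDl mulrAC !actD !actMX IHp mul_polyC actZ actC.
Qed.

Lemma actX u n : act 'X u n = u n.+1.
Proof. by rewrite -['X]mul1r actMX act1. Qed.

Lemma actXsubC a u n : act ('X - a%:P) u n = u n.+1 - a * u n.
Proof. by rewrite actB actX actC. Qed.

Lemma act_eq0 p u n : (forall k, u k = 0) -> act p u n = 0.
Proof. by move=> u0; apply: big1 => i _; rewrite u0 mulr0. Qed.

Lemma act_dvd p q u : (forall n, act p u n = 0) -> forall n, act (q * p) u n = 0.
Proof. by move=> pu0 n; rewrite actM act_eq0. Qed.

Lemma act_unique_from_init p u : p \is monic -> (forall n, act p u n = 0) ->
  (forall n, (n < (size p).-1)%N -> u n = 0) -> forall n, u n = 0.
Proof.
move=> mp pu0 init n; elim/ltn_ind: n => n IHn.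
case: (ltnP n (size p).-1) => [|le]; first exact: init.
have sp : size p = (size p).-1.+1 by rewrite prednK // size_poly_gt0 monic_neq0.
have := pu0 (n - (size p).-1)%N; rewrite /act sp big_ord_recr /= subnK //.
rewrite -/(lead_coef p) (monicP mp) mul1r big1 ?add0r // => i _.
by rewrite IHn ?mulr0 // -[X in (_ < X)%N](subnK le) ltn_add2l.
Qed.

End Act.

Lemma act_map (F K : comNzRingType) (f : {rmorphism F -> K}) (p : {poly F}) u n :
  act (map_poly f p) (f \o u) n = f (act p u n).
Proof.
rewrite (@act_widen _ (size p) (map_poly f p)) ?size_poly // /act.
rewrite [RHS](rmorph_sum f).
by apply: eq_bigr => i _; rewrite coef_map rmorphM.
Qed.

(** ** Finite-dimensional shift-invariant spaces *)

(** The [V i] span a shift-invariant space containing [u]. The index is a finite type so that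
    products and sums of sequences are indexed by [I * J] and [I + J], whose cardinals bound the
    order of the recurrence. *)
Definition shift_space (F : comNzRingType) (I : finType) (u : nat -> F) : Prop :=
  exists (V : I -> nat -> F) (A : I -> I -> F) (c : I -> F),
    (forall i n, V i n.+1 = \sum_j A i j * V j n) /\
    (forall n, u n = \sum_i c i * V i n).

Section ShiftSpace.
Variable F : comNzRingType.
Implicit Types (I J : finType) (u v : nat -> F).

Lemma shift_space_ext I u v : u =1 v -> shift_space I u -> shift_space I v.
Proof.
by move=> e [V [A [c [hV hu]]]]; exists V, A, c; split=> // n; rewrite -e.
Qed.

Lemma shift_space_const (a : F) : shift_space unit (fun=> a).
Proof.
exists (fun _ _ => 1), (fun _ _ => 1), (fun=> a).
split=> *; rewrite big_const cardT enumT unlock /= ?mulr1 ?addr0 //.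
Qed.

Lemma shift_space_mul I J u v : shift_space I u -> shift_space J v ->
  shift_space (I * J)%type (fun n => u n * v n).
Proof.
move=> [V [A [c [hV hu]]]] [W [B [e [hW hv]]]].
exists (fun x n => V x.1 n * W x.2 n), (fun x y => A x.1 y.1 * B x.2 y.2),
  (fun x => c x.1 * e x.2); split=> [[i j] n|n].
  rewrite hV hW big_distrlr pair_big; apply: eq_bigr => -[k l] _ /=; ring.
rewrite hu hv big_distrlr pair_big; apply: eq_bigr => -[k l] _ /=; ring.
Qed.

Lemma shift_space_add I J u v : shift_space I u -> shift_space J v ->
  shift_space (I + J)%type (fun n => u n + v n).
Proof.
move=> [V [A [c [hV hu]]]] [W [B [e [hW hv]]]].
exists (fun x n => match x with inl i => V i n | inr j => W j n end),
  (fun x y => match x, y with inl i, inl j => A i j | inr i, inr j => B i j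
              | _, _ => 0 end),
  (fun x => match x with inl i => c i | inr j => e j end).
split=> [[i|j] n|n]; rewrite big_sumType /=.
- by rewrite hV [X in _ + X]big1 ?addr0 // => j _; rewrite mul0r.
- by rewrite hW [X in X + _]big1 ?add0r // => i _; rewrite mul0r.
- by rewrite hu hv.
Qed.

Lemma shift_space_scale I u (a : F) : shift_space I u ->
  shift_space I (fun n => a * u n).
Proof.
move=> [V [A [c [hV hu]]]]; exists V, A, (fun i => a * c i); split=> // n.
by rewrite hu mulr_sumr; apply: eq_bigr => i _; rewrite mulrA.
Qed.

Lemma shift_space_zero : shift_space void (fun=> 0 : F).
Proof.
exists (fun _ _ => 0), (fun _ _ => 0), (fun _ => 0).
by split=> [[]|n]; rewrite big_pred0 // => -[].
Qed.

(** The shift acts on the vector of the [V i] as the matrix [A]; by Cayley-Hamilton, the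
    characteristic polynomial of [A] kills each [V i]. *)
Lemma shift_space_killed I u : shift_space I u ->
  exists p : {poly F}, [/\ p \is monic, size p = #|I|.+1 & forall n, act p u n = 0].
Proof.
move=> [V [A [c [hV hu]]]].
case E : #|I| => [|m].
  exists 1; rewrite monic1 size_poly1; split=> // n; rewrite act1 hu.
  by rewrite big_pred0 // => i; have := card0_eq E i.
pose M := \matrix_(i < m.+1, j < m.+1)
  A (enum_val (cast_ord (esym E) i)) (enum_val (cast_ord (esym E) j)).
pose X n := \col_(i < m.+1) V (enum_val (cast_ord (esym E) i)) n.
have XS n : X n.+1 = M *m X n.
  apply/colP => i; rewrite !mxE hV.
  rewrite (reindex (fun k => enum_val (cast_ord (esym E) k))) /=; last first.
    exists (fun x => cast_ord E (enum_rank x)) => x _.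
      by rewrite enum_valK cast_ordKV.
    by rewrite cast_ordK enum_rankK.
  by apply: eq_bigr => k _; rewrite !mxE.
have Xn n k : X (n + k)%N = M ^+ k *m X n.
  elim: k => [|k IHk]; first by rewrite addn0 expr0 mul1mx.
  by rewrite addnS XS IHk exprS mulmxA.
exists (char_poly M); rewrite char_poly_monic size_char_poly; split=> // n.
have HX p : horner_mx M p *m X n = \sum_(i < size p) p`_i *: X (n + i)%N.
  rewrite -[in LHS](coefK p) poly_def [horner_mx M _]rmorph_sum mulmx_suml.
  apply: eq_bigr => i _.
  by rewrite -mul_polyC rmorphM rmorphXn /= horner_mx_C horner_mx_X Xn
    -mulmxE mul_scalar_mx scalemxAl.
have := HX (char_poly M); rewrite Cayley_Hamilton mul0mx /act.
move=> /esym/matrixP {}HX.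
under eq_bigr => i _ do rewrite hu mulr_sumr.
rewrite exchange_big big1 // => j _.
have := HX (cast_ord E (enum_rank j)) 0; rewrite !mxE summxE => H.
transitivity (c j * \sum_(i < size (char_poly M)) (char_poly M)`_i * V j (n + i)%N).
  by rewrite mulr_sumr; apply: eq_bigr => i _; ring.
rewrite -[RHS](mulr0 (c j)); congr (_ * _); rewrite -[RHS]H; apply: eq_bigr => i _.
by rewrite !mxE cast_ordK enum_rankK.
Qed.

End ShiftSpace.

(** * Annihilators and minimal polynomials *)

Definition kills (F : comNzRingType) (p : {poly F}) (u : nat -> F) : Prop :=
  forall n, act p u n = 0.

Definition is_minpoly (F : fieldType) (mu : {poly F}) (u : nat -> F) : Prop :=
  [/\ mu \is monic, kills mu u & forall q, kills q u -> mu %| q].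

Section MinPoly.
Variable F : fieldType.
Implicit Types (p q mu : {poly F}) (u : nat -> F).

Lemma kills_dvd p q u : p %| q -> kills p u -> kills q u.
Proof. by move=> /divpK <-; apply: act_dvd. Qed.

Lemma kills_modp p q u : kills p u -> kills q u -> kills (q %% p) u.
Proof.
move=> pu qu n; have -> : q %% p = q - q %/ p * p by rewrite {2}(divp_eq q p); ring.
by rewrite actB qu actM act_eq0 ?subr0.
Qed.

(** A nonzero annihilator of least degree is minimal: the remainder of any other annihilator modulo
    it is an annihilator of smaller degree, hence 0. *)
Lemma minpoly_ex p u : p != 0 -> kills p u -> exists mu, is_minpoly mu u.
Proof.
have [n] := ubnP (size p); elim: n p => // n IHn p lt_p p0 pu.
have [[q [q0 qu lt_q]]|minp] := EM (exists q, [/\ q != 0,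
  kills q u & (size q < size p)%N]).
  exact: (IHn q (leq_trans lt_q lt_p)).
exists ((lead_coef p)^-1 *: p); split=> [|k|q qu].
- by rewrite monicE lead_coefZ mulVf // lead_coef_eq0.
- by rewrite actZ pu mulr0.
rewrite dvdpZl ?invr_eq0 ?lead_coef_eq0 //; apply/modp_eq0P/eqP.
apply: contra_notT minp => m0; exists (q %% p); rewrite m0 ltn_modp p0.
by split=> //; exact: kills_modp.
Qed.

(** p(E) and q(E) commute, so q(E) u obeys the recurrence [p] as well and is determined by its first
    [N] terms. *)
Lemma kills_from_init p q u N : p \is monic -> size p = N.+1 -> kills p u ->
  (forall n, (n < N)%N -> act q u n = 0) -> kills q u.
Proof.
move=> mp sp pu q0; apply: (act_unique_from_init mp) => [n|n].
  by rewrite -actM mulrC; apply: act_dvd.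
by rewrite sp; exact: q0.
Qed.

End MinPoly.

(* The shifts of [u] of order less than the degree of [mu] are linearly
   independent; this is a statement on the rank of a matrix over [F]. *)
Lemma minpoly_map (F K : fieldType) (f : {rmorphism F -> K}) (mu : {poly F}) u :
  is_minpoly mu u -> is_minpoly (map_poly f mu) (f \o u).
Proof.
move=> [mmu muu minmu].
have kmap : kills (map_poly f mu) (f \o u).
  by move=> n; rewrite act_map muu rmorph0.
split=> // [|q qu]; first by rewrite map_monic.
apply/modp_eq0P; set r := q %% _.
have ru : kills r (f \o u) by exact: kills_modp.
have : (size r < size (map_poly f mu))%N.
  by rewrite ltn_modp map_poly_eq0 monic_neq0.
rewrite size_map_poly => lt_r.
have smu : size mu = (size mu).-1.+1 by rewrite prednK // size_poly_gt0 monic_neq0.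
pose m := (size mu).-1.
(* A Hankel matrix: multiplied by the coefficients of p, it lists the first m terms of p(E) u. By
   minimality of [mu] its rows are independent, a property that survives the field extension. *)
pose H := \matrix_(i < m, n < m) u (n + i)%N.
have actH (L : fieldType) (w : nat -> L) (p : {poly L}) : (size p <= m)%N ->
    poly_rV p *m (\matrix_(i < m, n < m) w (n + i)%N) = \row_(n < m) act p w n.
  move=> le_p; apply/rowP => n; rewrite !mxE (@act_widen _ m) //.
  by apply: eq_bigr => i _; rewrite !mxE.
have freeH : row_free H.
  apply: inj_row_free => v v0.
  have sv : (size (rVpoly v) <= m)%N by exact: size_poly.
  have := actH _ u _ sv; rewrite rVpolyK v0 => /rowP act0v.
  have kv : kills (rVpoly v) u.
    apply: (kills_from_init mmu smu muu) => n lt_n.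
    by have := act0v (Ordinal lt_n); rewrite !mxE.
  have /(_ kv) := minmu (rVpoly v).
  have [z|nz] := eqVneq (rVpoly v) 0; first by rewrite -(rVpolyK v) z linear0.
  by move/(dvdp_leq nz); rewrite leqNgt smu ltnS sv.
have sr : (size r <= m)%N by rewrite -ltnS -smu.
have H1 : map_mx f H = \matrix_(i < m, n < m) (f \o u) (n + i)%N.
  by apply/matrixP => i j; rewrite !mxE.
have : poly_rV r *m map_mx f H = 0.
  by rewrite H1 actH //; apply/rowP => n; rewrite !mxE ru.
rewrite -(row_free_map f) in freeH.
move=> e; have : poly_rV r = 0 :> 'rV_m.
  by apply: (row_free_inj freeH); rewrite e mul0mx.
by move=> /(congr1 rVpoly); rewrite poly_rV_K // linear0.
Qed.

(** ** Growth and the location of characteristic roots *)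

Lemma act_closed (F : comNzRingType) (P : (nat -> F) -> Prop) :
  (forall u v, u =1 v -> P u -> P v) ->
  (forall u, P u -> P (fun n => u n.+1)) ->
  (forall u v, P u -> P v -> P (fun n => u n + v n)) ->
  (forall a u, P u -> P (fun n => a * u n)) ->
  forall p u, P u -> P (act p u).
Proof.
move=> Pext PS PD PZ p u Pu; elim/poly_ind: p => [|p c IHp].
  by apply: Pext (PZ 0 u Pu) => n; rewrite act0 mul0r.
by apply: Pext (PD _ _ (PS _ IHp) (PZ c _ Pu)) => n; rewrite actD actMX actC.
Qed.

(* [u n = o(n)], stated without division. *)
Definition sublinear (K : numDomainType) (u : nat -> K) : Prop :=
  forall m : nat, exists N, forall n, (N <= n)%N -> `|u n| * m%:R <= n%:R.

Definition poly_bounded (K : numDomainType) (N : nat) (u : nat -> K) : Prop :=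
  exists A, forall n, `|u n| <= A * n.+1%:R ^+ N.

Definition bounded_seq (K : numDomainType) (u : nat -> K) : Prop :=
  exists A, forall n, `|u n| <= A.

Section Closure.
Variable K : archiNumFieldType.
Implicit Types (u v : nat -> K) (p : {poly K}).

Lemma poly_bounded_act N p u : poly_bounded N u -> poly_bounded N (act p u).
Proof.
apply: (act_closed (P := @poly_bounded K N)) => {u p}
  [u v e [A hA]|u [A hA]|u v [A hA] [B hB]|a u [A hA]].
- by exists A => n; rewrite -e.
- have A0 : 0 <= A by have := le_trans (normr_ge0 _) (hA 0); rewrite expr1n mulr1.
  exists (A * 2%:R ^+ N) => n; rewrite (le_trans (hA _)) // -mulrA -exprMn.
  by rewrite ler_wpM2l // lerXn2r ?nnegrE ?ler0n // -?natrM ?ler0n // ler_nat; lia.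
- by exists (A + B) => n; rewrite (le_trans (ler_normD _ _)) // mulrDl lerD.
- by exists (`|a| * A) => n; rewrite normrM -mulrA ler_wpM2l.
Qed.

Lemma sublinear_ext u v : u =1 v -> sublinear u -> sublinear v.
Proof.
by move=> e su m; have [N hN] := su m; exists N => n /hN; rewrite e.
Qed.

Lemma sublinear_act p u : sublinear u -> sublinear (act p u).
Proof.
apply: (act_closed (P := @sublinear K)) => {u p} [u v|u su m|u v su sv m|a u su m].
- exact: sublinear_ext.
(* Twice the precision absorbs the shift, since n + 1 <= 2 n for n > 0. *)
- have [N hN] := su m.*2; exists N.+1 => n lt_n.
  have := hN n.+1 (leqW (ltnW lt_n)); rewrite -addnn natrD mulrDr => h.
  rewrite -(ler_pM2r (ltr0n K 2)) mulr_natr mulr2n (le_trans h) //.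
  by rewrite -natrM ler_nat; lia.
- have [N hN] := su m.*2; have [M hM] := sv m.*2; exists (maxn N M) => n.
  rewrite geq_max => /andP[/hN h1 /hM h2].
  rewrite -(ler_pM2r (ltr0n K 2)) (_ : n%:R * 2 = n%:R + n%:R); last by ring.
  apply: le_trans (lerD h1 h2); rewrite -mulrDl -muln2 natrM mulrA.
  by do 2![apply: ler_wpM2r => //]; exact: ler_normD.
- have [N hN] := su (Num.bound `|a| * m)%N; exists N => n /hN.
  rewrite natrM mulrA; apply: le_trans; rewrite normrM [`|a| * _]mulrC.
  by apply: ler_wpM2r => //; apply: ler_wpM2l => //; rewrite ltW // archi_boundP.
Qed.

Lemma bounded_sublinear u : bounded_seq u -> sublinear u.
Proof.
move=> [A hA] m; have A0 : 0 <= A := le_trans (normr_ge0 _) (hA 0).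
exists (Num.bound (A * m%:R)) => n le_n.
apply: le_trans (_ : A * m%:R <= _); first by rewrite ler_wpM2r.
by rewrite (le_trans (ltW (archi_boundP _))) ?mulr_ge0 // ler_nat.
Qed.

Lemma bernoulli (d : K) n : 0 <= d -> 1 + d *+ n <= (1 + d) ^+ n.
Proof.
move=> d0; elim: n => [|n IHn]; first by rewrite addr0 expr0.
rewrite exprS; apply: le_trans (ler_wpM2l _ IHn); last by rewrite addr_ge0.
have -> : (1 + d) * (1 + d *+ n) = 1 + d *+ n.+1 + d * (d *+ n).
  by rewrite mulrS; set e := d *+ n; ring.
by rewrite lerDl mulr_ge0 // mulrn_wge0.
Qed.

Lemma sublinear_geometric (l a : K) :
  sublinear (fun n => a * l ^+ n) -> a != 0 -> `|l| <= 1.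
Proof.
move=> su a0; rewrite real_leNgt ?real1 ?normr_real //; apply/negP => l1.
have [d d0 ld] : exists2 d, 0 < d & `|l| = 1 + d.
  by exists (`|l| - 1); rewrite ?subr_gt0 // addrC subrK.
(* Chosen so that |a| d m > 1; by Bernoulli, |a l^n| m >= |a| d n m > n for n > 0. *)
pose m := Num.bound (`|a| * d)^-1.
have ad0 : 0 < `|a| * d by rewrite mulr_gt0 ?normr_gt0.
have hm : 1 < `|a| * d * m%:R.
  by rewrite mulrC -ltr_pdivrMr // mul1r archi_boundP // invr_ge0 ltW.
have [N hN] := su m; have := hN N.+1 (leqnSn N); apply/negP.
have -> : `|a * l ^+ N.+1| = `|a| * (1 + d) ^+ N.+1.
  by rewrite normrM normrX ld.
rewrite -real_ltNge ?realn ?ger0_real ?mulr_ge0 ?exprn_ge0 ?addr_ge0 ?(ltW d0) //.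
apply: lt_le_trans (_ : `|a| * (d *+ N.+1) * m%:R <= _); last first.
  rewrite ler_wpM2r // ler_wpM2l // (le_trans _ (bernoulli _ (ltW d0))) //.
  by rewrite lerDr.
rewrite -(mulr_natr d) (_ : _ * m%:R = N.+1%:R * (`|a| * d * m%:R)); last by ring.
by rewrite ltr_pMr // ltr0n.
Qed.

(** Along n = k (N + 1) and with d = |l| - 1, Bernoulli gives |l|^n >= (k d)^(N+1), of degree N + 1
    in k, while the assumed bound has degree N. *)
Lemma poly_bounded_geometric N (l a : K) :
  poly_bounded N (fun n => a * l ^+ n) -> a != 0 -> `|l| <= 1.
Proof.
move=> [A hA] a0; rewrite real_leNgt ?real1 ?normr_real //; apply/negP => l1.
have [d d0 ld] : exists2 d, 0 < d & `|l| = 1 + d.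
  by exists (`|l| - 1); rewrite ?subr_gt0 // addrC subrK.
have A0 : 0 <= A by have := le_trans (normr_ge0 _) (hA 0); rewrite expr1n mulr1.
have e0 : 0 < `|a| * d ^+ N.+1 by rewrite mulr_gt0 ?normr_gt0 ?exprn_gt0.
(* For k >= 1, k (N + 1) + 1 <= k (N + 2), so the assumed bound at the index k (N + 1) is at most B
   k^N. *)
pose B := A * N.+2%:R ^+ N.
have B0 : 0 <= B by rewrite mulr_ge0 ?exprn_ge0.
pose k := (Num.bound (B / (`|a| * d ^+ N.+1))).+1.
have hk : B < k%:R * (`|a| * d ^+ N.+1).
  rewrite -ltr_pdivrMr //; apply: lt_le_trans (archi_boundP _) _.
    by rewrite divr_ge0 // ltW.
  by rewrite ler_nat.
have := hA (k * N.+1)%N; apply/negP.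
rewrite -real_ltNge ?normr_real ?ger0_real ?mulr_ge0 ?exprn_ge0 //.
apply: le_lt_trans (_ : _ <= B * k%:R ^+ N) _.
  rewrite /B -mulrA -exprMn ler_wpM2l // lerXn2r ?nnegrE ?mulr_ge0 //.
  by rewrite -natrM ler_nat /k; lia.
apply: lt_le_trans (_ : _ < k%:R * (`|a| * d ^+ N.+1) * k%:R ^+ N) _.
  by rewrite ltr_pM2r // exprn_gt0 // ltr0n.
rewrite normrM normrX exprM.
have -> : k%:R * (`|a| * d ^+ N.+1) * k%:R ^+ N = `|a| * (d *+ k) ^+ N.+1.
  by rewrite -(mulr_natr d) exprMn [k%:R ^+ N.+1]exprS; ring.
rewrite ler_wpM2l // lerXn2r ?nnegrE ?mulrn_wge0 ?exprn_ge0 ?(ltW d0) //.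
rewrite ld (le_trans _ (bernoulli _ (ltW d0))) //.
by rewrite lerDr.
Qed.

Lemma geometric (l : K) y : (forall n, y n.+1 = l * y n) ->
  forall n, y n = y 0 * l ^+ n.
Proof.
by move=> yS; elim=> [|n IHn]; rewrite ?mulr1 // yS IHn exprS; ring.
Qed.

(** Solving the recurrence gives l z(n) = l^n (l z(0) + n y(0)); for |l| = 1 its modulus grows
    linearly unless y(0) = 0. *)
Lemma sublinear_resonance (l : K) z y : `|l| = 1 -> sublinear z ->
  (forall n, z n.+1 = l * z n + y n) -> (forall n, y n.+1 = l * y n) -> y 0 = 0.
Proof.
move=> l1 sz zS yS; apply/eqP/negPn/negP => y0.
have zn n : l * z n = l ^+ n * (l * z 0 + n%:R * y 0).
  elim: n => [|n IHn]; first by rewrite mul1r mul0r addr0.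
  by rewrite zS mulrDr IHn (geometric yS n) exprS -natr1; ring.
have lb n : n%:R * `|y 0| <= `|z n| + `|z 0|.
  have -> : `|z n| = `|l * z 0 + n%:R * y 0|.
    by have := congr1 Num.norm (zn n); rewrite !normrM normrX l1 expr1n !mul1r.
  have -> : `|z 0| = `|l * z 0| by rewrite normrM l1 mul1r.
  apply: le_trans (ler_normB _ _).
  by rewrite addrAC subrr add0r normrM normr_nat.
pose m := (Num.bound (2 / `|y 0|)).
have hm : 2 < m%:R * `|y 0|.
  by rewrite -ltr_pdivrMr ?normr_gt0 // archi_boundP // divr_ge0.
have [N hN] := sz m; pose n := maxn N (Num.bound (`|z 0| * m%:R)).+1.
have := hN n (leq_maxl _ _).
have n_gt0 : (0 < n)%N by rewrite leq_max orbT.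
have hz : `|z 0| * m%:R < n%:R.
  apply: lt_le_trans (archi_boundP _) _; first by rewrite mulr_ge0.
  by rewrite ler_nat leq_max leqnSn orbT.
move=> H; have := ler_wpM2r (ler0n K m) (lb n); rewrite mulrDl.
apply/negP; rewrite -real_ltNge ?ger0_real ?addr_ge0 ?mulr_ge0 //.
apply: le_lt_trans (_ : n%:R + n%:R < _) => //; first by rewrite lerD // ltW.
rewrite (_ : n%:R + n%:R = n%:R * 2); last by ring.
by rewrite -mulrA ltr_pM2l ?ltr0n // mulrC.
Qed.

End Closure.

(** With mu = g (X - l), the sequence g(E) u is geometric of ratio l, and not zero because g has
    smaller degree than [mu]. Each root thus shows in the growth of a sequence generated by [u]. *)
Lemma minpoly_root (K : fieldType) (mu : {poly K}) u l :
  is_minpoly mu u -> root mu l ->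
  exists g a, a != 0 /\ forall n, act g u n = a * l ^+ n.
Proof.
move=> [mmu muu minmu] /factor_theorem[g def_mu].
have gS n : act g u n.+1 = l * act g u n.
  by apply/eqP; rewrite -subr_eq0 -actXsubC -actM mulrC -def_mu muu.
have gE : forall n, act g u n = act g u 0 * l ^+ n.
  by elim=> [|n IHn]; rewrite ?mulr1 // gS IHn exprS mulrCA.
exists g, (act g u 0); split=> //; apply/eqP => g0.
have : kills g u by move=> n; rewrite gE g0 mul0r.
have nz_g : g != 0.
  by apply: contraTneq (monic_neq0 mmu) => z; rewrite def_mu z mul0r eqxx.
move=> /minmu/(dvdp_leq nz_g); rewrite def_mu size_Mmonic ?monicXsubC //.
by rewrite size_XsubC addn2 ltnn.
Qed.

Section RootGrowth.
Variable K : archiNumFieldType.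
Implicit Types (u : nat -> K) (s : seq K).

Lemma minpoly_root_sublinear (mu : {poly K}) u l :
  is_minpoly mu u -> sublinear u -> root mu l -> `|l| <= 1.
Proof.
move=> min_mu su /(minpoly_root min_mu)[g [a [a0 gE]]].
by apply: (sublinear_geometric (sublinear_ext gE (sublinear_act g su))).
Qed.

Lemma minpoly_root_poly_bounded N (mu : {poly K}) u l :
  is_minpoly mu u -> poly_bounded N u -> root mu l -> `|l| <= 1.
Proof.
move=> min_mu su /(minpoly_root min_mu)[g [a [a0 gE]]].
apply: (poly_bounded_geometric (N := N) (a := a)) => //.
by have [A hA] := poly_bounded_act g su; exists A => n; rewrite -gE.
Qed.

(* Applying [E - z] at most doubles the initial values, and undoing it amounts to
   a summation, which costs a factor [k + 1]. *)
Lemma growth_of_roots s u A : kills (\prod_(z <- s) ('X - z%:P)) u ->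
  {in s, forall z, `|z| <= 1} -> (forall i, (i < size s)%N -> `|u i| <= A) ->
  0 <= A -> forall k, `|u k| <= A * 2%:R ^+ size s * k.+1%:R ^+ size s.
Proof.
elim: s u A => [|z s IHs] u A ku s1 uA A0 k.
  by have := ku k; rewrite big_nil act1 => ->; rewrite normr0 !mulr1.
have z1 : `|z| <= 1 by apply: s1; rewrite mem_head.
pose y := act ('X - z%:P) u.
have yE n : u n.+1 = z * u n + y n by rewrite /y actXsubC; ring.
have {IHs} hy n : `|y n| <= A * 2%:R * 2%:R ^+ size s * n.+1%:R ^+ size s.
  apply: IHs => [m|t ts|i lt_i|]; rewrite ?mulr_ge0 //.
  - by have := ku m; rewrite big_cons mulrC actM.
  - by apply: s1; rewrite inE ts orbT.
  - rewrite /y actXsubC mulr_natr mulr2n (le_trans (ler_normB _ _)) // lerD ?uA //.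
    rewrite normrM -[A]mul1r (le_trans (ler_wpM2r _ z1)) // ler_wpM2l //.
    by rewrite uA // ltnW.
pose B : K := A * 2%:R ^+ (size s).+1.
have B0 : 0 <= B by rewrite mulr_ge0 ?exprn_ge0.
have AB : A <= B by rewrite ler_peMr // exprn_ege1 // ler1n.
rewrite /= -/B; elim: k => [|k IHk].
  by rewrite expr1n mulr1 (le_trans _ AB) // uA.
rewrite yE (le_trans (ler_normD _ _)) //.
apply: le_trans (_ : B * k.+1%:R ^+ (size s).+1 + B * k.+2%:R ^+ size s <= _).
  apply: lerD.
    rewrite normrM (le_trans (ler_wpM2r _ z1)) // mul1r //.
  apply: le_trans (hy k) _; rewrite -(mulrA A) -exprS ler_wpM2l //.
  by rewrite lerXn2r ?nnegrE ?ler0n // ler_nat.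
rewrite -mulrDr ler_wpM2l // ![_ ^+ (size s).+1]exprS.
rewrite -[k.+2%:R in X in _ <= X * _]natr1 mulrDl mul1r lerD2r ler_wpM2l //.
by rewrite lerXn2r ?nnegrE ?ler0n // ler_nat.
Qed.

Lemma bounded_first_order (z : K) u y : `|z| < 1 -> bounded_seq y ->
  (forall n, u n.+1 = z * u n + y n) -> bounded_seq u.
Proof.
(* [B] is at least |u(0)| and satisfies |z| B + A <= B, so it is preserved by the recurrence. *)
move=> z1 [A hA] uS; pose B := `|u 0| + A / (1 - `|z|).
have d0 : 0 < 1 - `|z| by rewrite subr_gt0.
have A0 : 0 <= A := le_trans (normr_ge0 _) (hA 0).
exists B; elim=> [|n IHn]; first by rewrite lerDl divr_ge0 // ltW.
rewrite uS (le_trans (ler_normD _ _)) // normrM.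
apply: le_trans (lerD (ler_wpM2l (normr_ge0 z) IHn) (hA n)) _.
rewrite -subr_ge0 (_ : _ - _ = (1 - `|z|) * `|u 0|).
  by rewrite mulr_ge0 // ltW.
by rewrite /B; field; rewrite gt_eqF.
Qed.

(* Two distinct roots [z] and [t] are handled through
   [(z - t) u = (E - t) u - (E - z) u]. *)
Lemma bounded_of_roots s u : kills (\prod_(z <- s) ('X - z%:P)) u ->
  {in s, forall z, `|z| < 1 \/ `|z| = 1 /\ (count_mem z s <= 1)%N} ->
  bounded_seq u.
Proof.
have [n] := ubnP (size s); elim: n s u => // n IHn [|z s] u lt_s ku hs.
  by exists 0 => n'; have := ku n'; rewrite big_nil act1 => ->; rewrite normr0.
have hsub t : subseq t (z :: s) ->
    {in t, forall z, `|z| < 1 \/ `|z| = 1 /\ (count_mem z t <= 1)%N}.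
  move=> st x xt; have xs := mem_subseq st xt.
  case: (hs x xs) => [?|[x1 c1]]; [by left|right; split=> //].
  by apply: leq_trans c1; apply: leq_count_subseq.
have kz : kills (\prod_(t <- s) ('X - t%:P)) (act ('X - z%:P) u).
  by move=> m; have := ku m; rewrite big_cons mulrC actM.
have bz : bounded_seq (act ('X - z%:P) u).
  by apply: IHn kz (hsub _ (subseq_cons _ _)).
have [z1|[z1 cz]] := hs z (mem_head _ _).
  by apply: (bounded_first_order z1 bz) => m; rewrite actXsubC; ring.
case: s => [|t s] in lt_s ku hs hsub kz cz *.
  exists `|u 0|; elim=> // m IHm.
  have := kz m; rewrite big_nil act1 actXsubC => /eqP.
  by rewrite subr_eq0 => /eqP ->; rewrite normrM z1 mul1r.
have nzt : z - t != 0.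
  rewrite subr_eq0; apply: contraTneq cz => ->.
  by rewrite /= eqxx.
have bt : bounded_seq (act ('X - t%:P) u).
  apply: (IHn (z :: s)) => //.
    by move=> m; have := ku m; rewrite !big_cons mulrCA mulrC actM.
  by apply: hsub; rewrite /= !eqxx; apply: subseq_cons.
have [A hA] := bz; have [B hB] := bt.
exists ((B + A) / `|z - t|) => m; rewrite ler_pdivlMr ?normr_gt0 // -normrM.
have -> : u m * (z - t) = act ('X - t%:P) u m - act ('X - z%:P) u m.
  by rewrite !actXsubC; ring.
by rewrite (le_trans (ler_normB _ _)) ?lerD.
Qed.

End RootGrowth.

(* Otherwise the minimal polynomial of [act (f * g) u] has a root on the circle,
   which [f] turns into a resonance for a sequence generated by [u]. *)
Lemma sublinear_kills_circle_part (f g : {poly algC}) N (u : nat -> algC) :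
  sublinear u -> (forall l, root f l -> `|l| = 1) ->
  kills (f ^+ N * g) u -> kills (f * g) u.
Proof.
move=> su f1 kN; pose v := act (f * g) u.
have f0 : f != 0.
  by apply/eqP => z; have := f1 0; rewrite z root0 normr0 => /(_ isT)/esym/eqP;
    rewrite oner_eq0.
have kv : kills (f ^+ N) v.
  by move=> n; rewrite /v -actM mulrCA; apply: act_dvd.
have [nu min_nu] := minpoly_ex (expf_neq0 N f0) kv.
have [mnu knu divnu] := min_nu.
have [/eqP s1|] := boolP (size nu == 1%N).
  have nu1 : nu = 1.
    have := monicP mnu; rewrite lead_coefE s1 => c1.
    by rewrite [nu]size1_polyC ?s1 // c1.
  by move=> n; have := knu n; rewrite nu1 act1.
move=> /closed_rootP[l nul]; exfalso.
have fl : root f l.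
  have : root (f ^+ N) l by apply: root_dvdp nul; exact: divnu.
  by rewrite /root horner_exp expf_eq0 => /andP[].
have [g' [a [a0 g'E]]] := minpoly_root min_nu nul.
have /factor_theorem[f' fE] := fl.
(* As f = f' (X - l), where f' is a cofactor and not a derivative, E - l maps [z] to [y], a
   geometric sequence of ratio l with y(0) = a nonzero. *)
pose z := act (g' * f' * g) u; pose y := act g' v.
suff : y 0 = 0 by rewrite /y g'E expr0 mulr1 => /eqP; rewrite (negbTE a0).
apply: (sublinear_resonance (f1 l fl) (sublinear_act (g' * f' * g) su)) => n.
  rewrite -/z; have -> : y n = act ('X - l%:P) z n.
    rewrite /y /v /z -!actM fE; congr (act _ u n); ring.
  by rewrite actXsubC; ring.
by rewrite /y !g'E exprS; ring.
Qed.

(** * Polynomials with roots in the unit disc *)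

Definition dominated (R : numDomainType) (P : {poly R}) : bool :=
  \sum_(i < (size P).-1) `|P`_i| < `|lead_coef P|.

(** At a root with |l| >= 1, the leading term of degree K would be at most the sum of the |P_i|
    |l|^i with i < K, hence at most that of the |P_i| times |l|^K. *)
Lemma dominated_root (K : numFieldType) (P : {poly K}) l :
  dominated P -> root P l -> `|l| < 1.
Proof.
rewrite /dominated => domP /rootP Pl.
rewrite real_ltNge ?real1 ?normr_real //; apply/negP => l1.
have P0 : P != 0.
  by apply: contraTneq domP => ->; rewrite size_poly0 big_ord0 lead_coef0 normr0
    ltxx.
move: domP; apply/negP; rewrite -real_leNgt ?normr_real ?ger0_real ?sumr_ge0 //.
have sP : size P = (size P).-1.+1 by rewrite prednK // size_poly_gt0.
set K' := (size P).-1 in sP *.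
have lK : 0 < `|l| ^+ K' by rewrite exprn_gt0 // (lt_le_trans ltr01).
rewrite -(ler_pM2r lK) -normrX -normrM.
move: Pl; rewrite horner_coef sP big_ord_recr /= lead_coefE -/K' => /eqP.
rewrite addr_eq0 => /eqP e; rewrite -normrN -e mulr_suml.
apply: le_trans (ler_norm_sum _ _ _) _; apply: ler_sum => i _.
rewrite normrM !normrX; apply: ler_wpM2l => //.
by apply: ler_weXn2l => //; exact: ltnW.
Qed.

(** The reciprocal X^m p(1/X) for the formal degree m. *)
Definition revp (R : nzRingType) (m : nat) (p : {poly R}) : {poly R} :=
  \poly_(i < m.+1) p`_(m - i).

Lemma horner_revp (K : fieldType) m (p : {poly K}) z : (size p <= m.+1)%N ->
  z != 0 -> (revp m p).[z] = z ^+ m * p.[z^-1].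
Proof.
move=> le_p z0; rewrite horner_poly (horner_coef_wide _ le_p) mulr_sumr.
rewrite (reindex_inj rev_ord_inj) /=; apply: eq_bigr => i _.
have le_i : (i <= m)%N by rewrite -ltnS.
by rewrite subSS subKn // mulrCA exprVn expfB_cond ?(negbTE z0) // addr0.
Qed.

Lemma map_revp (R S : nzRingType) (f : {rmorphism R -> S}) m (p : {poly R}) :
  map_poly f (revp m p) = revp m (map_poly f p).
Proof.
apply/polyP => i; rewrite coef_map ![(revp _ _)`_i]coef_poly; case: ifP => _.
  by rewrite coef_map.
exact: rmorph0.
Qed.

Lemma size_deriv (K : numDomainType) (p : {poly K}) : size p^`() = (size p).-1.
Proof.
have [->|p0] := eqVneq p 0; first by rewrite derivC size_poly0.
have sp : size p = (size p).-1.+1 by rewrite prednK // size_poly_gt0.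
apply/eqP; rewrite eqn_leq -ltnS -sp lt_size_deriv //=.
case E : (size p).-1 => [//|m]; rewrite ltnNge; apply/negP =>
  /leq_sizeP/(_ m (leqnn m)).
rewrite coef_deriv => /eqP; rewrite mulrn_eq0 /= -E -lead_coefE lead_coef_eq0.
exact/negP.
Qed.

(** * Cohn's criterion for simple roots on the circle *)

Section Circle.
Implicit Types (f g : {poly algC}) (l z : algC) (s : seq algC).

(** Compares numerator and denominator of the Blaschke factor (l - z) / (1 - conj(z) l): which one
    is larger depends only on the sides of the circle on which l and z lie. *)
Lemma blaschke l z :
  `|l - z| ^+ 2 - `|1 - z^* * l| ^+ 2 = (`|l| ^+ 2 - 1) * (1 - `|z| ^+ 2).
Proof.
rewrite !normCK !rmorphB !rmorphM /= conjCK conjC1; ring.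
Qed.

Lemma blaschke_ge l z : `|z| <= 1 -> 1 <= `|l| -> `|1 - z^* * l| <= `|l - z|.
Proof.
move=> z1 l1; rewrite -(@ler_pXn2r _ 2) ?nnegrE // -subr_ge0 blaschke.
by rewrite mulr_ge0 // subr_ge0 ?exprn_ege1 // exprn_ile1.
Qed.

Lemma blaschke_le l z : `|z| <= 1 -> `|l| <= 1 -> `|l - z| <= `|1 - z^* * l|.
Proof.
move=> z1 l1; rewrite -(@ler_pXn2r _ 2) ?nnegrE // -subr_le0 blaschke.
by rewrite mulr_le0_ge0 // ?subr_le0 ?subr_ge0 exprn_ile1.
Qed.

Lemma conj_inv_circle z : `|z| = 1 -> z^-1 = z^*.
Proof. by move=> z1; rewrite invC_norm z1 expr1n invr1 mul1r. Qed.

(* Cohn: if [f] is self-reciprocal then [n f - z f'] is, up to a unit, the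
   reciprocal of [f'], and a Blaschke comparison excludes [f z = 0] off the
   circle. *)
Lemma self_reciprocal_root f n l : map_poly (@Num.conj algC) f = f ->
  size f = n.+2 -> f \is monic ->
  (forall i, (i <= n.+1)%N -> f`_i = f`_0 * f`_(n.+1 - i)) ->
  (forall z, root f^`() z -> `|z| < 1) -> root f l -> `|l| = 1.
Proof.
move=> fJ sf mf frev d1 /rootP fl.
have lf : f`_n.+1 = 1 by have := monicP mf; rewrite lead_coefE sf.
have f00 : f`_0 * f`_0 = 1 by rewrite -[RHS]lf [RHS]frev // subnn.
have nf0 : `|f`_0| = 1.
  apply/eqP; rewrite -(@eqrXn2 _ 2) // expr1n expr2 -normrM f00 normr1 //.
have f0 : f`_0 != 0 by rewrite -normr_gt0 nf0 ltr01.
have l0 : l != 0.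
  by apply: contraNneq f0 => z; rewrite -horner_coef0 -{1}z fl.
pose d := f^`().
have sd : size d = n.+1 by rewrite /d size_deriv sf.
have idp : n.+1%:R *: f - 'X * d = f`_0 *: revp n d.
  apply/polyP => i; rewrite coefB !coefZ coefXM [(revp n d)`_i]coef_poly /d
    !coef_deriv.
  case: (ltnP i n.+1) => [lt_i|le_i].
    have -> : (n - i).+1 = (n.+1 - i)%N by rewrite subSn.
    rewrite mulrnAr -frev ?(ltnW lt_i) //.
    case: i lt_i => [|i] lt_i /=; first by rewrite subr0 subn0 mulr_natl.
    by rewrite mulr_natl -mulrnBr // ltnW.
  rewrite mulr0; case: i le_i => // i le_i /=.
  rewrite mulr_natl; have [->|ne] := eqVneq i n; first by rewrite subrr.
  by rewrite nth_default ?mul0rn ?subrr // sf; lia.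
(* At the root l, the identity gives |l d(l)| = |l^n d(1/l)|; both sides are now factored over the
   roots of d. *)
have := congr1 (fun p => `|p.[l]|) idp.
rewrite !hornerE fl mulr0 sub0r normrN !normrM nf0 mul1r horner_revp ?sd //.
have [s dE] := closed_field_poly_normal d.
set c := lead_coef d in dE.
have c0 : c != 0 by rewrite lead_coef_eq0 -size_poly_eq0 sd.
have ss : size s = n.
  by have := sd; rewrite dE size_scale // size_prod_XsubC => -[].
(* The coefficients of d are invariant under conjugation, so its roots may be conjugated; this
   yields the factors 1 - conj(z) l. *)
have dE' : d = c^* *: \prod_(z <- s) ('X - (z^*)%:P).
  have dJ : map_poly (@Num.conj algC) d = d by rewrite /d -deriv_map fJ.
  rewrite -[LHS]dJ dE map_polyZ rmorph_prod; congr (_ *: _).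
  by apply: eq_bigr => z _; rewrite rmorphB /= map_polyX map_polyC.
have s1 z : z \in s -> `|z| < 1.
  by move=> zs; apply: d1; rewrite -/d dE rootZ // root_prod_XsubC.
have -> : `|d.[l]| = `|c| * \prod_(z <- s) `|l - z|.
  rewrite dE hornerZ normrM horner_prod normr_prod; congr (_ * _).
  by apply: eq_bigr => z _; rewrite !hornerE.
have -> : l ^+ n * d.[l^-1] = c^* * \prod_(z <- s) (1 - z^* * l).
  rewrite dE' hornerZ horner_prod mulrCA; congr (_ * _); rewrite -ss.
  elim: s {dE dE' ss s1} => [|z s IHs]; first by rewrite !big_nil mulr1.
  rewrite !big_cons /= exprS -IHs hornerXsubC.
  have -> : 1 - z^* * l = l * (l^-1 - z^*) by field.
  ring.
rewrite normrM norm_conjC normr_prod mulrCA => /(mulfI _) e.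
have {}e : `|l| * \prod_(z <- s) `|l - z| = \prod_(z <- s) `|1 - z^* * l|.
  by apply: e; rewrite normr_eq0.
(* Off the circle, the Blaschke comparison and the factor |l| err in the same direction, so the
   equality [e] fails strictly. *)
have [lt1|gt1|//] := real_ltgtP (normr_real l) (real1 _).
- have Q0 : 0 < \prod_(z <- s) `|1 - z^* * l|.
    rewrite big_seq; apply: prodr_gt0 => z zs; rewrite normr_gt0 subr_eq0.
    apply: contraTneq (s1 z zs) => e1; rewrite -real_leNgt ?real1 ?normr_real //.
    have : `|z| * `|l| = 1 by rewrite -norm_conjC -normrM -e1 normr1.
    by move=> <-; rewrite ler_piMr // ltW.
  have : `|l| * \prod_(z <- s) `|l - z| < \prod_(z <- s) `|1 - z^* * l|.
    apply: le_lt_trans (_ : _ <= `|l| * \prod_(z <- s) `|1 - z^* * l|) _.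
      rewrite ler_wpM2l // !big_seq; apply: ler_prod => z zs.
      by rewrite normr_ge0 blaschke_le ?ltW // s1.
    by rewrite gtr_pMl.
  by rewrite e ltxx.
- have P0 : 0 < \prod_(z <- s) `|l - z|.
    rewrite big_seq; apply: prodr_gt0 => z zs; rewrite normr_gt0 subr_eq0.
    by apply: contraTneq (s1 z zs) => <-; rewrite lt_gtF.
  have : \prod_(z <- s) `|1 - z^* * l| < `|l| * \prod_(z <- s) `|l - z|.
    apply: le_lt_trans (_ : _ <= \prod_(z <- s) `|l - z|) _.
      rewrite !big_seq; apply: ler_prod => z zs.
      by rewrite normr_ge0 blaschke_ge ?ltW // s1.
    by rewrite ltr_pMl.
  by rewrite e ltxx.
Qed.

Lemma logderiv_prod s l : l \notin s ->
  (\prod_(z <- s) ('X - z%:P))^`().[l]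
    = (\prod_(z <- s) ('X - z%:P)).[l] * \sum_(z <- s) (l - z)^-1.
Proof.
elim: s => [|z s IHs]; first by rewrite !big_nil derivE horner0 mulr0.
rewrite inE negb_or => /andP[lz /IHs {}IHs].
rewrite !big_cons derivM derivXsubC !hornerE IHs.
by field; rewrite subr_eq0.
Qed.

(* Gauss-Lucas for simple roots on the circle: [z f'/f] has real part at least
   [n / 2] outside the open disc. *)
Lemma circle_deriv_root s l : uniq s -> s != [::] -> {in s, forall z, `|z| = 1} ->
  root (\prod_(z <- s) ('X - z%:P))^`() l -> `|l| < 1.
Proof.
move=> us s0 s1 rl; rewrite real_ltNge ?normr_real ?real1 //; apply/negP => l1.
have ls : l \notin s.
  apply/negP => ls; have := us; rewrite -separable_prod_XsubC unlock => cop.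
  have /(coprimep_root cop) : root (\prod_(z <- s) ('X - z%:P)) l.
    by rewrite root_prod_XsubC.
  by rewrite -rootE rl.
move: rl; rewrite rootE logderiv_prod // mulf_eq0 -rootE root_prod_XsubC (negbTE
  ls) /=.
move=> /eqP e0.
have l0 : l != 0 by rewrite -normr_gt0 (lt_le_trans ltr01).
pose w z := l / (l - z).
have sumw : \sum_(z <- s) (w z + (w z)^*) = 0.
  rewrite big_split /= -rmorph_sum /= /w -mulr_sumr e0 mulr0 conjC0 addr0 //.
have : (size s)%:R <= \sum_(z <- s) (w z + (w z)^*).
  have -> : (size s)%:R = \sum_(z <- s) 1 :> algC.
    by rewrite big_const_seq count_predT iter_addr_0.
  rewrite !big_seq; apply: ler_sum => z zs.
  have lz : l - z != 0 by rewrite subr_eq0; apply: contraNneq ls => ->.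
  have lzc : l^* - z^* != 0 by rewrite -rmorphB conjC_eq0.
  rewrite -subr_ge0 /w rmorphM fmorphV rmorphB /=.
  (* Twice the real part of l / (l - z), minus 1, has the sign of |l|^2 - |z|^2. Hence a sum over
     the roots that vanishes would be at least their number. *)
  have -> : l / (l - z) + l^* / (l^* - z^*) - 1 =
      (`|l| ^+ 2 - `|z| ^+ 2) / `|l - z| ^+ 2.
    by rewrite !normCK rmorphB; field; rewrite lz lzc.
  rewrite (s1 z zs) expr1n; apply: divr_ge0; last exact: exprn_ge0.
  by rewrite subr_ge0 exprn_ege1.
by rewrite sumw lern0 size_eq0 (negbTE s0).
Qed.

End Circle.

(** The commutator of p(E) with multiplication by the index is p'(E) E. *)
Lemma act_mul_index (F : comNzRingType) (p : {poly F}) u n :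
  act p (fun k => k%:R * u k) n = n%:R * act p u n + act (p^`() * 'X) u n.
Proof.
elim/poly_ind: p n => [|p c IHp] n; first by rewrite deriv0 mul0r !act0; ring.
rewrite derivD derivC addr0 derivM derivX mulr1 mulrDl.
by rewrite !actD !actMX !actC IHp !actMX -natr1; ring.
Qed.

Lemma kills_mul_index (F : comNzRingType) (p : {poly F}) u :
  kills p u -> kills (p * p) (fun k => k%:R * u k).
Proof.
move=> pu n; rewrite actM.
transitivity (act p (act (p^`() * 'X) u) n).
  by apply: eq_act => k; rewrite act_mul_index pu mulr0 add0r.
by rewrite -actM mulrC; apply: act_dvd.
Qed.

(** * Rational polynomials and their complex roots *)

Notation toC p := (map_poly (ratr : rat -> algC) p).

Lemma kills_toC p (u : nat -> rat) : kills (toC p) (ratr \o u) <-> kills p u.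
Proof.
split=> pu n; last by rewrite act_map pu rmorph0.
by apply/eqP; have /eqP := pu n; rewrite act_map fmorph_eq0.
Qed.

Lemma dominated_toC_root (P : {poly rat}) l : dominated P -> root (toC P) l ->
  `|l| < 1.
Proof.
move=> dP; apply: dominated_root; rewrite /dominated size_map_poly lead_coef_map.
under eq_bigr => i _ do rewrite coef_map -ratr_norm.
by rewrite -rmorph_sum -ratr_norm ltr_rat.
Qed.

Lemma toC_split (p : {poly rat}) : p != 0 ->
  exists s : seq algC, toC p = ratr (lead_coef p) *: \prod_(z <- s) ('X - z%:P).
Proof.
by move=> p0; have [s] := closed_field_poly_normal (toC p);
  rewrite lead_coef_map; exists s.
Qed.

Lemma kills_scale (F : fieldType) (a : F) (p : {poly F}) u :
  a != 0 -> kills (a *: p) u -> kills p u.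
Proof.
by move=> a0 pu n; apply: (mulfI a0); rewrite -actZ pu mulr0.
Qed.

(** Reduction modulo [g] is linear, so each coefficient of X^k mod g is a recurrent sequence in k;
    taking q = g shows that [g] kills it. *)
Lemma act_modp (F : fieldType) (g q : {poly F}) i n :
  act q (fun k => ('X^k %% g)`_i) n = (('X^n * q) %% g)`_i.
Proof.
elim/poly_ind: q n => [|q c IHq] n; first by rewrite act0 mulr0 mod0p coef0.
rewrite actD actMX actC IHq -coefZ -modpZl -coefD -modpD; congr ((_ %% _)`_ _).
by rewrite exprS -mul_polyC; ring.
Qed.

Section StableCertificate.
Variable g : {poly rat}.
Hypotheses (g0 : g != 0) (g1 : forall l, root (toC g) l -> `|l| < 1).

(* [n * c n] is killed by [g * g], hence bounded. *)
Lemma modp_coef_cvg0 i m : exists N, forall n, (N <= n)%N ->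
  `|('X^n %% g)`_i| * m%:R <= 1.
Proof.
pose c k := ('X^k %% g)`_i.
have kc : kills g c by move=> n; rewrite act_modp modp_mull coef0.
have [s gE] := toC_split g0.
have lg : ratr (lead_coef g) != 0 :> algC by rewrite fmorph_eq0 lead_coef_eq0.
have : kills (toC g * toC g) (fun k => k%:R * (ratr \o c) k).
  exact/kills_mul_index/kills_toC.
rewrite gE -scalerAl -scalerAr => /(kills_scale lg)/(kills_scale lg).
rewrite -big_cat => /bounded_of_roots[z|A hA].
  rewrite mem_cat orbb => zs; left; apply: g1.
  by rewrite gE rootZ // root_prod_XsubC.
have A0 : 0 <= A := le_trans (normr_ge0 _) (hA 0).
exists (Num.bound (A * m%:R)).+1 => n lt_n.
rewrite -(ler_rat algC) rmorphM rmorph1 rmorph_nat /= ratr_norm.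
have n0 : 0 < n%:R :> algC by rewrite ltr0n; case: n lt_n.
rewrite -(ler_pM2l n0) mulr1 mulrA.
have := hA n; rewrite normrM normr_nat => h;
  apply: le_trans (ler_wpM2r _ h) _ => //.
apply: le_trans (ltW (archi_boundP _)) _; first by rewrite mulr_ge0.
by rewrite ler_nat ltnW.
Qed.

(** X^K - (X^K mod g) is a multiple of [g] with leading coefficient 1, and its other coefficients
    tend to 0 as K grows, since the roots of [g] lie in the open disc. *)
Lemma stable_certificate : exists h, dominated (h * g).
Proof.
pose m := size g.
(* The remainder has at most m coefficients; with each of them at most 1 / (m + 1), their sum stays
   below 1. *)
have [N hN] := boolp.choice (fun i => modp_coef_cvg0 i m.+1).
pose K := (size g + \max_(i < m) N i)%N.
exists ('X^K %/ g).
have -> : 'X^K %/ g * g = 'X^K - 'X^K %% g by rewrite {2}(divp_eq 'X^K g) addrK.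
have lt_r : (size (- ('X^K %% g))%R < size ('X^K : {poly rat})%R)%N.
  rewrite size_polyN size_polyXn ltnS (leq_trans (ltnW (ltn_modpN0 _ g0))) //.
  exact: leq_addr.
rewrite /dominated lead_coefDl // size_polyDl // lead_coefXn normr1 size_polyXn /=.
have le_mK : (m <= K)%N by exact: leq_addr.
rewrite (eq_bigr (fun i : 'I_K => `|('X^K %% g)`_i|)) => [|i _]; last first.
  by rewrite coefB coefXn ltn_eqF // sub0r normrN.
have -> : \sum_(i < K) `|('X^K %% g)`_i| = \sum_(i < m) `|('X^K %% g)`_i|.
  rewrite (big_ord_widen _ (fun i => `|('X^K %% g)`_i|) le_mK) [RHS]big_mkcond.
  apply: eq_bigr => i _; case: ltnP => // le_i; rewrite nth_default ?normr0 //.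
  by rewrite (leq_trans (ltnW (ltn_modpN0 _ g0))).
apply: le_lt_trans (_ : _ <= \sum_(i < m) m.+1%:R^-1) _.
  apply: ler_sum => i _; rewrite -[X in _ <= X]mul1r ler_pdivlMr ?ltr0n // hN //.
  by rewrite /K (leq_trans _ (leq_addl _ _)) // (leq_bigmax (F :=
    fun i : 'I_m => N i)).
by rewrite sumr_const card_ord -(mulr_natl _ m) ltr_pdivrMr ?ltr0n // mul1r ltr_nat.
Qed.

End StableCertificate.

(** * Certificates for sublinearity *)

(** For monic f, the top index gives f_0^2 = 1, so f equals its reciprocal up to sign. *)
Definition self_reciprocal (f : {poly rat}) : bool :=
  [forall i : 'I_(size f), f`_i == f`_0 * f`_((size f).-1 - i)].

Definition certifies (f g h1 h2 : {poly rat}) : bool :=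
  [&& lead_coef f == 1, (1 < size f)%N, self_reciprocal f,
      dominated (h1 * f^`()) & dominated (h2 * g)].

(* The bound of [growth_of_roots], with the initial values majorized by their
   sum. *)
Definition growth_bound (N : nat) (u : nat -> rat) (k : nat) : rat :=
  (\sum_(i < N) `|u i|) * 2%:R ^+ N * k.+1%:R ^+ N.

Lemma sublinear_ratr (K : archiNumFieldType) (u : nat -> rat) :
  sublinear ((ratr : rat -> K) \o u) <-> sublinear u.
Proof.
have e m n : (`|ratr (u n) : K| * m%:R <= n%:R) = (`|u n| * m%:R <= n%:R).
  by rewrite -ratr_norm -[m%:R in LHS](ratr_nat K) -[n%:R in LHS](ratr_nat K)
    -rmorphM ler_rat.
by split=> su m; have [N hN] := su m; exists N => n /hN; rewrite /= e.
Qed.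

Lemma conj_toC (p : {poly rat}) : map_poly (@Num.conj algC) (toC p) = toC p.
Proof. by rewrite -map_poly_comp; apply: eq_map_poly => x /=;
  exact: fmorph_rat. Qed.

Lemma horner_conj_toC (p : {poly rat}) (z : algC) : (toC p).[z^*] = ((toC p).[z])^*.
Proof. by rewrite -[in LHS](conj_toC p) horner_map. Qed.

Section Certified.
Variables f g h1 h2 : {poly rat}.
Hypothesis cert : certifies f g h1 h2.

Let mf : f \is monic. Proof. by have [] := and5P cert. Qed.

Lemma certified_deriv_root l : root (toC f)^`() l -> `|l| < 1.
Proof.
have [_ _ _ dh _] := and5P cert; rewrite deriv_map => rl.
by apply: (dominated_toC_root dh); rewrite rmorphM rootM rl orbT.
Qed.

Lemma certified_circle l : root (toC f) l -> `|l| = 1.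
Proof.
have [_ sf rf _ _] := and5P cert.
case E : (size f) sf => [|[|n]] // _.
apply: (@self_reciprocal_root _ n); rewrite ?map_monic ?size_map_poly ?conj_toC //.
- move=> i le_i; rewrite !coef_map -rmorphM /=.
  move: rf => /forallP rf; have lt_i : (i < size f)%N by rewrite E.
  by have /eqP := rf (Ordinal lt_i); rewrite /= E => ->.
- exact: certified_deriv_root.
Qed.

Lemma certified_disc l : root (toC g) l -> `|l| < 1.
Proof.
have [_ _ _ _ dh] := and5P cert => rl.
by apply: (dominated_toC_root dh); rewrite rmorphM rootM rl orbT.
Qed.

(** The roots of [f] are simple, as they lie on the circle while those of its derivative lie inside;
    they also differ from the roots of [g], so [bounded_of_roots] applies. *)
Lemma certified_bounded u : kills (f * g) u ->
  bounded_seq ((ratr : rat -> algC) \o u).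
Proof.
have g0 : g != 0.
  apply/eqP => g0; have := certified_disc (l := 1).
  by rewrite g0 rmorph0 root0 normr1 ltxx => /(_ isT).
move=> /kills_toC; rewrite rmorphM /=.
have f0 : f != 0 by exact: monic_neq0.
have [s fE] := toC_split f0; have [t gE] := toC_split g0.
have lf : ratr (lead_coef f) != 0 :> algC by rewrite fmorph_eq0 lead_coef_eq0.
have lg : ratr (lead_coef g) != 0 :> algC by rewrite fmorph_eq0 lead_coef_eq0.
rewrite {1}fE {1}gE -scalerAl -scalerAr => /(kills_scale lf)/(kills_scale lg).
rewrite -big_cat => /bounded_of_roots; apply => z.
rewrite mem_cat => /orP[zs|zt]; last first.
  by left; apply: certified_disc; rewrite gE rootZ // root_prod_XsubC.
have z1 : `|z| = 1 by apply: certified_circle; rewrite fE rootZ // root_prod_XsubC.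
right; split=> //; rewrite count_cat.
have us : uniq s.
  rewrite -separable_prod_XsubC unlock.
  rewrite -(coprimepZl _ _ lf) -fE -(coprimepZr _ _ lf) -derivZ -fE.
  apply/Pdiv.ClosedField.coprimepP => x rx; apply/negP => rx'.
  by have := certified_deriv_root rx'; rewrite certified_circle ?ltxx.
rewrite count_uniq_mem // zs (count_memPn _) //.
apply/negP => zt; have := certified_disc (l := z).
by rewrite gE rootZ // root_prod_XsubC zt z1 ltxx => /(_ isT).
Qed.

(** Under a certificate sublinear means bounded: a repeated root on the circle would produce a
    resonance, and without one the sequence is bounded. *)
Lemma certified_decision N u : kills (f ^+ N * g) u ->
  sublinear u <-> kills (f * g) u.
Proof.
move=> kN; split=> [su|/certified_bounded/bounded_sublinear/sublinear_ratr//].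
apply/kills_toC; rewrite rmorphM; apply: (sublinear_kills_circle_part (N := N)).
- exact/sublinear_ratr.
- exact: certified_circle.
- by rewrite -rmorphXn -rmorphM; apply/kills_toC.
Qed.

End Certified.

Section Growth.
Variables (p0 : {poly rat}) (N : nat) (u : nat -> rat).
Hypotheses (mp : p0 \is monic) (sp : size p0 = N.+1) (kp : kills p0 u).

Lemma minpoly_size mu : is_minpoly mu u -> (size mu <= N.+1)%N.
Proof.
by move=> [_ _ /(_ _ kp) dv]; rewrite -sp dvdp_leq // monic_neq0.
Qed.

(** Sublinearity puts the roots of the minimal polynomial in the closed disc, where
    [growth_of_roots] applies. The contrapositive makes an index that exceeds the bound a
    refutation. *)
Lemma sublinear_growth_bound : sublinear u -> forall k,
  `|u k| <= growth_bound N u k.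
Proof.
move=> su k; have [mu min_mu] := minpoly_ex (monic_neq0 mp) kp.
have smu := minpoly_size min_mu.
have [mmu kmu _] := min_mu; have mu0 := monic_neq0 mmu.
have [s muE] := toC_split mu0.
have ss : (size s <= N)%N.
  move: smu; rewrite -(size_map_poly
    (ratr : {rmorphism rat -> algC})) muE (monicP mmu).
  by rewrite rmorph1 scale1r size_prod_XsubC.
have minC := minpoly_map (ratr : {rmorphism rat -> algC}) min_mu.
move: (proj2 (kills_toC mu u) kmu); rewrite muE (monicP mmu) rmorph1 scale1r => ks.
pose A : rat := \sum_(i < N) `|u i|.
have A0 : 0 <= A by rewrite sumr_ge0.
rewrite -(ler_rat algC) ratr_norm.
apply: le_trans (growth_of_roots (A := ratr A) ks _ _ _ k) _.
- move=> z zs; apply: (minpoly_root_sublinear minC); first exact/sublinear_ratr.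
  by rewrite muE (monicP mmu) rmorph1 scale1r root_prod_XsubC.
- move=> i lt_i; rewrite /= -ratr_norm ler_rat /A.
  have lt_iN : (i < N)%N := leq_trans lt_i ss.
  by rewrite (bigD1 (Ordinal lt_iN)) //= lerDl sumr_ge0.
- by rewrite ler0q.
(* The minimal polynomial may have degree less than [N]; the bound increases with the exponent. *)
- rewrite /growth_bound !rmorphM !rmorphXn !rmorph_nat -/A /=.
  move: (ratr A) (ler0q algC A); rewrite A0 => a a0.
  apply: ler_pM; [by apply: mulr_ge0; rewrite ?exprn_ge0 | by apply: exprn_ge0 | |].
    by apply: ler_wpM2l => //; apply: ler_weXn2l => //; rewrite ler1n.
  by apply: ler_weXn2l => //; rewrite ler1n.
Qed.

End Growth.

(* [p] is the gcd of [nu] and its reciprocal polynomial. *)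
Lemma circle_part (nu : {poly rat}) : nu != 0 ->
  (forall l, root (toC nu) l -> `|l| <= 1) ->
  exists2 p : {poly rat}, p != 0 &
    forall l, root (toC p) l <-> root (toC nu) l /\ `|l| = 1.
Proof.
move=> nu0 nu1; pose n := (size nu).-1.
have sn : size nu = n.+1 by rewrite prednK // size_poly_gt0.
have rrev l : l != 0 -> (toC (revp n nu)).[l] = l ^+ n * (toC nu).[l^-1].
  by move=> l0; rewrite map_revp horner_revp // size_map_poly sn.
exists (gcdp nu (revp n nu)) => [|l]; first by rewrite gcdp_eq0 (negbTE nu0).
(* A root l of the gcd and its inverse are both roots of [nu], hence both in the closed disc.
   Conversely, the inverse of a circle root is its conjugate, again a root of [nu]. *)
rewrite gcdp_map root_gcd; split=> [/andP[rl rl']|[rl l1]].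
  split=> //; apply/eqP; rewrite eq_le nu1 //=.
  have l0 : l != 0.
    apply: contraTneq rl' => ->; rewrite rootE horner_coef0 coef_map fmorph_eq0.
    by rewrite coef_poly subn0 -lead_coefE lead_coef_eq0.
  move: rl'; rewrite rootE rrev // mulf_eq0 expf_eq0 (negbTE l0) andbF /=.
  by move/nu1; rewrite normfV invf_le1 // normr_gt0.
have l0 : l != 0 by rewrite -normr_gt0 l1.
rewrite rl rootE rrev // conj_inv_circle // horner_conj_toC (rootP rl).
by rewrite conjC0 mulr0 eqxx.
Qed.

(** Dividing p by its gcd with p' keeps every root: if a root of multiplicity k + 1 were lost, (X -
    l)^(k+1) would divide p', which is impossible in characteristic 0. *)
Lemma squarefree_part (p : {poly rat}) : p != 0 ->
  exists f : {poly rat}, [/\ f \is monic, separable_poly (toC f) &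
    forall l, root (toC f) l = root (toC p) l].
Proof.
move=> p0; pose d := gcdp p p^`(); pose f := p %/ d.
have pE : p = f * d by rewrite divpK // dvdp_gcdl.
have f0 : f != 0 by apply: contraNneq p0 => z; rewrite pE z mul0r.
have lf : (lead_coef f)^-1 != 0 by rewrite invr_eq0 lead_coef_eq0.
exists ((lead_coef f)^-1 *: f); split=> [||l].
- by rewrite monicE lead_coefZ mulVf // lead_coef_eq0.
- by rewrite separable_map unlock coprimepZl // derivZ coprimepZr //;
    have := make_separable p0; rewrite unlock.
rewrite map_polyZ rootZ ?fmorph_eq0 //.
apply/idP/idP => [rl|rl]; first by rewrite pE rmorphM rootM rl.
apply/negPn/negP => nrl.
have [[|k] [q]] := multiplicity_XsubC (toC p) l; rewrite map_poly_eq0 p0 /= =>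
  nq pEk.
  by move: rl; rewrite pEk mulr1 (negbTE nq).
have : ('X - l%:P) ^+ k.+1 %| (toC p)^`().
  rewrite deriv_map; apply: (@dvdp_trans _ (toC d));
    last by rewrite dvdp_map dvdp_gcdr.
  rewrite -(@Gauss_dvdpr _ _ (toC f)); last by rewrite coprimep_expl //
    coprimep_sym coprimep_XsubC.
  by rewrite (_ : toC f * toC d = toC p) ?[in RHS]pE ?rmorphM // pEk dvdp_mull.
rewrite {1}pEk derivM deriv_exp derivXsubC mul1r dvdp_addr; last exact: dvdp_mull.
rewrite exprS mulrnAr -mulrnAl /= dvdp_mul2r ?expf_neq0 ?polyXsubC_eq0 //.
rewrite dvdp_XsubCl -scaler_nat rootZ ?pnatr_eq0 //.
exact/negP.
Qed.

(** The roots are simple and stable under inversion, which is conjugation on the circle, so [f]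
    divides its reciprocal. By degrees the quotient is constant, and the leading coefficients show
    that it is f_0. *)
Lemma circle_self_reciprocal (f : {poly rat}) : f \is monic ->
  separable_poly (toC f) -> (forall l, root (toC f) l -> `|l| = 1) ->
  self_reciprocal f.
Proof.
move=> mf sepf f1; have f0 := monic_neq0 mf; pose n := (size f).-1.
have sn : size f = n.+1 by rewrite prednK // size_poly_gt0.
have [s fE] := toC_split f0; rewrite (monicP mf) rmorph1 scale1r in fE.
have dv : f %| revp n f.
  rewrite -(dvdp_map (ratr : {rmorphism rat -> algC})) /= fE;
    apply: uniq_roots_dvdp.
    apply/allP => z zs; have rz : root (toC f) z by rewrite fE root_prod_XsubC.
    have z1 := f1 z rz; have z0 : z != 0 by rewrite -normr_gt0 z1.
    rewrite rootE map_revp horner_revp ?size_map_poly ?sn // conj_inv_circle //.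
    by rewrite horner_conj_toC (rootP rz) conjC0 mulr0 eqxx.
  by rewrite uniq_rootsE -separable_prod_XsubC -fE.
have rE : revp n f = f`_0 *: f.
  have [q qE] := dvdpP _ _ dv.
  have sq : (size q <= 1)%N.
    have [->|q0] := eqVneq q 0; first by rewrite size_poly0.
    have := size_poly n.+1 (fun i => f`_(n - i)); rewrite -/(revp n f) qE.
    by rewrite size_Mmonic // sn addnS /= -[X in (_ <= X)%N]add1n leq_add2r.
  rewrite qE (size1_polyC sq) mul_polyC; congr (_ *: _).
  have := congr1 (fun p : {poly rat} => p`_n) qE.
  rewrite (size1_polyC sq) mul_polyC coefZ coef_poly ltnSn subnn => ->.
  by have := monicP mf; rewrite lead_coefE sn => ->; rewrite mulr1 coefC.
apply/forallP => -[i lt_i] /=; rewrite -/n.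
have le_i : (i <= n)%N by rewrite -ltnS -sn.
have := congr1 (fun p : {poly rat} => p`_(n - i)) rE.
by rewrite coefZ coef_poly ltnS leq_subr subKn // => ->.
Qed.

(** Take g = mu / gcd(mu, f^N). A circle root has multiplicity at most deg mu <= N in [mu], so the
    gcd absorbs it entirely. *)
Lemma stable_cofactor N (mu f : {poly rat}) :
  mu != 0 -> (size mu <= N.+1)%N -> f != 0 ->
  (forall l, root (toC mu) l -> `|l| <= 1) ->
  (forall l, root (toC mu) l -> `|l| = 1 -> root (toC f) l) ->
  exists g, [/\ g != 0, mu %| f ^+ N * g & forall l, root (toC g) l -> `|l| < 1].
Proof.
move=> mu0 smu f0 mu1 muf; pose d := gcdp mu (f ^+ N); pose g := mu %/ d.
have muE : mu = g * d by rewrite divpK // dvdp_gcdl.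
have g0 : g != 0 by apply: contraNneq mu0 => z; rewrite muE z mul0r.
exists g; split=> // [|l rl].
  by rewrite muE mulrC dvdp_mul // dvdp_gcdr.
have rmu : root (toC mu) l by rewrite muE rmorphM rootM rl.
rewrite lt_neqAle mu1 // andbT; apply/eqP => l1.
have rf := muf l rmu l1.
have mu0' : toC mu != 0 by rewrite map_poly_eq0.
pose k := mup l (toC mu).
have le_kN : (k <= N)%N.
  have : ('X - l%:P) ^+ k %| toC mu by rewrite -mup_geq.
  move/(dvdp_leq mu0'); rewrite size_map_poly => le.
  by have := leq_trans le smu; rewrite size_exp_XsubC ltnS.
have dvd_d : ('X - l%:P) ^+ k %| toC d.
  rewrite gcdp_map dvdp_gcd -mup_geq // leqnn /= rmorphXn.
  apply: dvdp_trans (dvdp_exp2l _ le_kN) _.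
  by rewrite dvdp_exp2r // dvdp_XsubCl.
have : ('X - l%:P) ^+ k.+1 %| toC mu.
  by rewrite muE rmorphM exprS dvdp_mul // dvdp_XsubCl.
by rewrite -mup_geq // ltnn.
Qed.

Section Existence.
Variables (p0 : {poly rat}) (N : nat) (u : nat -> rat).
Hypotheses (mp : p0 \is monic) (sp : size p0 = N.+1) (kp : kills p0 u).

Lemma certificate_exists : (forall k, `|u k| <= growth_bound N u k) ->
  exists f g h1 h2, certifies f g h1 h2 /\ kills (f ^+ N * g) u.
Proof.
move=> ub; have [mu min_mu] := minpoly_ex (monic_neq0 mp) kp.
have smu := minpoly_size mp sp kp min_mu.
have [mmu kmu _] := min_mu; have mu0 := monic_neq0 mmu.
have minC := minpoly_map (ratr : {rmorphism rat -> algC}) min_mu.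
have mu1 l : root (toC mu) l -> `|l| <= 1.
  apply: (minpoly_root_poly_bounded (N := N) minC).
  exists (ratr ((\sum_(i < N) `|u i|) * 2%:R ^+ N)) => k.
  have := ub k; rewrite -(ler_rat algC) ratr_norm /growth_bound rmorphM.
  by rewrite (rmorphXn _ N k.+1%:R) rmorph_nat.
(* The factor X - 1 keeps [f] from being constant, as [certifies] demands, even if [mu] has no root
   on the circle. *)
pose nu := ('X - 1) * mu.
have nuE l : root (toC nu) l = (l == 1) || root (toC mu) l.
  rewrite rmorphM rootM rmorphB /= map_polyX rmorph1 -[X in 'X - X]/(1%:P).
  by rewrite root_XsubC.
have nu0 : nu != 0 by rewrite mulf_neq0 // -[X in 'X - X]/(1%:P) polyXsubC_eq0.
have nu1 l : root (toC nu) l -> `|l| <= 1.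
  by rewrite nuE => /orP[/eqP ->|/mu1 //]; rewrite normr1.
have [p p_neq0 rp] := circle_part nu0 nu1.
have [f [mf sepf rf]] := squarefree_part p_neq0.
have f0 := monic_neq0 mf.
have f1 l : root (toC f) l -> `|l| = 1 by rewrite rf => /rp[].
have rf1 : root (toC f) 1.
  by rewrite rf; apply/rp; rewrite nuE eqxx normr1.
have sf : (1 < size f)%N.
  by rewrite -(size_map_poly (ratr : {rmorphism rat ->
    algC})) (root_size_gt1 _ rf1) // map_poly_eq0.
have [g [g0 dvg g1]] : exists g, [/\ g != 0, mu %| f ^+ N * g &
    forall l, root (toC g) l -> `|l| < 1].
  apply: stable_cofactor => // l rl l1.
  by rewrite rf; apply/rp; rewrite nuE rl orbT.
have [h2 dh2] := stable_certificate g0 g1.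
have d0 : f^`() != 0.
  by rewrite -size_poly_eq0 size_deriv; case: (size f) sf => [|[]].
have [h1 dh1] : exists h, dominated (h * f^`()).
  apply: stable_certificate => // l; rewrite -deriv_map.
  have [s fE] := toC_split f0; rewrite (monicP mf) rmorph1 scale1r in fE.
  rewrite fE; apply: circle_deriv_root.
  - by rewrite -separable_prod_XsubC -fE.
  - by move: rf1; rewrite fE root_prod_XsubC; case: (s).
  - by move=> z zs; apply: f1; rewrite fE root_prod_XsubC.
exists f, g, h1, h2; split; last exact: kills_dvd dvg kmu.
by rewrite /certifies (monicP mf) eqxx sf circle_self_reciprocal // dh1.
Qed.

End Existence.

Local Open Scope classical_set_scope.
Local Open Scope ring_scope.

(** * Averages of linear recurrent sequences *)

Section Averages.
Variable R : realType.
Implicit Types (a : R^nat) (u : nat -> rat).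

Lemma cvgn_natP a (l : R) : a @ \oo --> l <->
  forall m : nat, exists N, forall n, (N <= n)%N -> `|l - a n| * m.+1%:R <= 1.
Proof.
split=> [/cvgrPdist_le al m|al].
  have /al[N _ hN] : 0 < (m.+1%:R : R)^-1 by rewrite invr_gt0 ltr0n.
  exists N => n le_n; rewrite -ler_pdivlMr ?ltr0n // div1r.
  exact: hN.
apply/cvgrPdist_le => e e0; have [N hN] := al (Num.bound e^-1).
exists N => // n /hN; rewrite -ler_pdivlMr ?ltr0n // div1r => h.
apply: le_trans h _; rewrite -[X in _ <= X]invrK lef_pV2 ?posrE ?invr_gt0 ?ltr0n //.
rewrite (le_trans (ltW (archi_boundP _))) ?invr_ge0 ?(ltW e0) //.
by rewrite ler_nat.
Qed.

(** If the averages a(n) tend to l, then w(n) = (n + 1) a(n + 1) - n a(n) differs from l by o(n). *)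
Lemma cvg_average_sublinear (w : R^nat) :
  cvgn (fun n => n%:R^-1 * \sum_(0 <= k < n) w k : R) -> sublinear w.
Proof.
set S := fun n => \sum_(0 <= k < n) w k => /cvg_ex[/= l /cvgn_natP al] m.
(* The deviations of the two averages contribute at most (2 n + 1) / 4 to |w(n)| m; the condition n
   >= 2 B makes room for the term |l| m. *)
have [N hN] := al (4 * m.+1)%N.
pose B := Num.bound (m%:R * `|l| + 1).
exists (maxn N.+1 (2 * B))%N => n; rewrite geq_max => /andP[lt_N le_B].
have n0 : n%:R != 0 :> R by rewrite pnatr_eq0; case: n lt_N {le_B}.
have wE : w n = - (n.+1%:R * (l - n.+1%:R^-1 * S n.+1)) +
    n%:R * (l - n%:R^-1 * S n) + l.
  rewrite /S big_nat_recr //= -natr1; field; rewrite n0 /=.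
  by rewrite natr1 pnatr_eq0.
have h1 := hN n.+1 (leqW (ltnW lt_N)); have h2 := hN n (ltnW lt_N).
have hm : 0 <= m%:R :> R by [].
have b k : (N <= k)%N -> `|l - k%:R^-1 * S k| * m%:R <= 4^-1.
  move=> /hN h; rewrite -(ler_pM2r (ltr0n R 4)) mulVf ?pnatr_eq0 //.
  apply: le_trans h; rewrite -mulrA ler_wpM2l // -natrM ler_nat; lia.
rewrite wE; apply: (@le_trans _ _ (n.+1%:R * 4^-1 + n%:R * 4^-1 + `|l| * m%:R)).
  apply: le_trans (ler_wpM2r hm (ler_normD _ _)) _; rewrite mulrDl lerD2r.
  apply: le_trans (ler_wpM2r hm (ler_normD _ _)) _; rewrite mulrDl normrN.
  rewrite !normrM !normr_nat -!mulrA lerD // ler_wpM2l // b //; lia.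
have hB : m%:R * `|l| + 1 < B%:R.
  by apply: archi_boundP; rewrite addr_ge0 // mulr_ge0.
have hn : 2 * B%:R <= n%:R :> R by rewrite -natrM ler_nat.
rewrite -natr1; move: hB hn; rewrite mulrC; set x := _ * m%:R; lra.
Qed.

(** A double root of the minimal polynomial mu at 1 would be a resonance for l = 1. So either mu or
    mu / (X - 1) has a nonzero value at 1, and is normalized by it. *)
Lemma averaging_poly_ex (p : {poly rat}) u : p \is monic -> kills p u ->
  sublinear u -> exists phi : {poly rat}, phi.[1] = 1 /\ kills (('X - 1) * phi) u.
Proof.
move=> mp kp su; have [mu min_mu] := minpoly_ex (monic_neq0 mp) kp.
have [mmu kmu dmu] := min_mu.
suff [k k1 kk] : exists2 k : {poly rat}, k.[1] != 0 & kills (('X - 1) * k) u.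
  exists (k.[1]^-1 *: k); rewrite hornerZ mulVf //; split=> // n.
  by rewrite -scalerAr actZ kk mulr0.
have [/factor_theorem[k muE]|mu1] := boolP (root mu 1); last first.
  by exists mu; rewrite -?rootE //; apply: kills_dvd kmu; exact: dvdp_mull.
exists k; last by rewrite -[X in 'X - X]/(1%:P) mulrC -muE.
apply/negP => /factor_theorem[k' kE].
have kS n : act k u n.+1 = 1 * act k u n.
  by apply/eqP; rewrite -subr_eq0 -actXsubC -actM mulrC -muE kmu.
have := sublinear_resonance (normr1 _) (sublinear_act k' su) (y := act k u) _ kS.
have zS n : act k' u n.+1 = 1 * act k' u n + act k u n.
  have -> : act k u n = act ('X - 1%:P) (act k' u) n by rewrite -actM mulrC -kE.
  by rewrite actXsubC; ring.
move=> /(_ zS) k0; have kk : kills k u.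
  by elim=> [//|n IHn]; rewrite kS IHn mulr0.
have k_neq0 : k != 0 by apply: contraTneq (monic_neq0 mmu) => z;
  rewrite muE z mul0r eqxx.
have := dvdp_leq k_neq0 (dmu k kk).
by rewrite muE size_Mmonic ?monicXsubC // size_XsubC addn2 ltnn.
Qed.

(** phi(E) u is a constant r. As phi - 1 = psi (X - 1), u(n) = r - (w(n + 1) - w(n)) with w = psi(E)
    u: the sum telescopes, and w is sublinear like u. *)
Lemma average_cvg (phi : {poly rat}) u : sublinear u ->
  phi.[1] = 1 -> kills (('X - 1) * phi) u ->
  (fun n => n%:R^-1 * \sum_(0 <= k < n) ratr (u k) : R) @ \oo
    --> (ratr (act phi u 0) : R).
Proof.
move=> su phi1 kphi; set r := act phi u 0.
have phiC n : act phi u n = r.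
  elim: n => // n <-; apply/eqP.
  have := kphi n; rewrite actM -[X in 'X - X]/(1%:P) actXsubC mul1r => /eqP.
  by rewrite subr_eq0.
have /factor_theorem[psi psiE] : root (phi - 1) 1.
  by rewrite rootE !hornerE phi1 subrr.
pose w := act psi u.
have uE n : u n = r - (w n.+1 - w n).
  rewrite -(phiC n) (_ : phi = 1 + psi * ('X - 1%:P)); last by rewrite -psiE; ring.
  by rewrite actD act1 mulrC actM actXsubC /w; ring.
have SE n : \sum_(0 <= k < n) u k = n%:R * r - (w n - w 0).
  elim: n => [|n IHn]; first by rewrite big_geq // mul0r; ring.
  by rewrite big_nat_recr //= IHn uE -natr1; ring.
have sw : sublinear (fun n => w n - w 0).
  have b : sublinear (fun=> - w 0 : rat) by apply: bounded_sublinear;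
    exists `|- w 0|.
  move=> m; have [N1 h1] := sublinear_act psi su (m * 2)%N.
  have [N2 h2] := b (m * 2)%N; exists (maxn N1 N2) => n.
  rewrite geq_max => /andP[/h1 {}h1 /h2 {}h2]; move: h1 h2;
    rewrite natrM !mulrA => h1 h2.
  have := ler_wpM2r (ler0n rat m) (ler_normD (w n) (- w 0)); rewrite mulrDl.
  move: h1 h2; rewrite -/(w n); lra.
apply/cvgn_natP => m; have [N hN] := sw m.+1; exists N.+1 => n lt_n.
have n0 : 0 < n%:R :> R by rewrite ltr0n; case: n lt_n.
have -> : \sum_(0 <= k < n) ratr (u k) = ratr (n%:R * r - (w n - w 0)) :> R.
  by rewrite -SE rmorph_sum.
rewrite rmorphB rmorphM /= ratr_nat mulrBr mulKf ?gt_eqF //.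
rewrite opprB addrC subrK normrM normfV normr_nat -mulrA mulrC ler_pdivrMr // mul1r.
have := hN n (ltnW lt_n).
by rewrite -(ler_rat R) rmorphM /= !ratr_nat ratr_norm.
Qed.

End Averages.

(** * The weights along the orbit as a linear recurrent sequence *)

Section Payoff.
Variables (R : realType) (d : nat) (M : 'M[rat]_d) (q : 'cV[rat]_d).

Definition payoff_seq (p : mpoly d rat) (k : nat) : rat :=
  meval (fun i => (M ^+ k *m q) i 0) p.

Lemma payoff_seq_terms (s : seq (rat * multinom d)) k :
  payoff_seq (mpoly_of_terms s) k =
  \sum_(t <- s) t.1 * \prod_(i < d) (M ^+ k *m q) i 0 ^+ t.2 i.
Proof.
rewrite /payoff_seq /mpoly_of_terms rmorph_sum; apply: eq_bigr => t _.
by rewrite /= mevalZ mevalX.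
Qed.

Lemma mpoly_of_terms_surj (p : mpoly d rat) : exists s, p = mpoly_of_terms s.
Proof. by have [c [s ? _]] := encodes_ex M q p; exists s. Qed.

Lemma poly_weightE p k :
  poly_weight R p (orbit_point R M q k) = ratr (payoff_seq p k).
Proof.
have [s ->] := mpoly_of_terms_surj p; rewrite payoff_seq_terms /poly_weight.
rewrite /mpoly_of_terms [map_mpoly _ _]raddf_sum [meval _ _]raddf_sum.
rewrite [RHS]raddf_sum; apply: eq_bigr => t _.
rewrite /= map_mpolyZ map_mpolyX mevalZ mevalX rmorphM rmorph_prod.
by congr (_ * _); apply: eq_bigr => i _; rewrite /= mxE rmorphXn.
Qed.

Lemma payoff_averageE p : payoff_average (poly_weight R p) M q =
  (fun n => n%:R^-1 * \sum_(0 <= k < n) ratr (payoff_seq p k)).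
Proof.
apply/funext => n; rewrite /payoff_average; congr (_ * _).
by apply: eq_bigr => k _; rewrite poly_weightE.
Qed.

(** The coordinates of M^k q span a shift-invariant space with d generators. A monomial of degree e
    is a product of e coordinates, which costs d^e generators, and the numbers add up over the
    terms. *)
Definition order_bound (s : seq (rat * multinom d)) : nat :=
  \sum_(t <- s) d ^ (\sum_(i < d) t.2 i).

Definition shift_dim (N : nat) (u : nat -> rat) :=
  exists2 I : finType, #|I| = N & shift_space I u.

Lemma shift_dim_prod (I : Type) (r : seq I) (N : I -> nat) (u : I -> nat -> rat) :
  (forall i, shift_dim (N i) (u i)) ->
  shift_dim (\prod_(i <- r) N i) (fun n => \prod_(i <- r) u i n).
Proof.
move=> hu; elim: r => [|i r [J cJ rJ]].
  exists unit; first by rewrite card_unit big_nil.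
  by apply: shift_space_ext (shift_space_const 1) => n; rewrite big_nil.
have [I' cI' rI'] := hu i; exists (I' * J)%type.
  by rewrite card_prod big_cons cI' cJ.
by apply: shift_space_ext (shift_space_mul rI' rJ) => n; rewrite big_cons.
Qed.

Lemma shift_dim_sum (I : Type) (r : seq I) (N : I -> nat) (u : I -> nat -> rat) :
  (forall i, shift_dim (N i) (u i)) ->
  shift_dim (\sum_(i <- r) N i) (fun n => \sum_(i <- r) u i n).
Proof.
move=> hu; elim: r => [|i r [J cJ rJ]].
  exists void; first by rewrite card_void big_nil.
  by apply: shift_space_ext (shift_space_zero _) => n; rewrite big_nil.
have [I' cI' rI'] := hu i; exists (I' + J)%type.
  by rewrite card_sum big_cons cI' cJ.
by apply: shift_space_ext (shift_space_add rI' rJ) => n; rewrite big_cons.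
Qed.

Lemma shift_dim_coord (i : 'I_d) : shift_dim d (fun k => (M ^+ k *m q) i 0).
Proof.
exists 'I_d; first exact: card_ord.
exists (fun i k => (M ^+ k *m q) i 0), (fun i j => M i j), (fun j => (j == i)%:R).
split=> [j n|n]; first by rewrite exprS -mulmxE -mulmxA mxE.
rewrite (bigD1 i) //= eqxx mul1r big1 ?addr0 // => j /negbTE ->.
by rewrite mul0r.
Qed.

Lemma shift_dim_ext N u v : u =1 v -> shift_dim N u -> shift_dim N v.
Proof. by move=> e [I cI rI]; exists I => //; apply: shift_space_ext e rI. Qed.

Lemma shift_dim_payoff (s : seq (rat * multinom d)) :
  shift_dim (order_bound s) (payoff_seq (mpoly_of_terms s)).
Proof.
apply: shift_dim_ext (fun k => esym (payoff_seq_terms s k)) _.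
apply: shift_dim_sum => t; set v := fun k : nat => _.
have : shift_dim (\prod_(i < d) \prod_(j < t.2 i) d)
    (fun k => \prod_(i < d) \prod_(j < t.2 i) (M ^+ k *m q) i 0).
  by apply: shift_dim_prod => i; apply: shift_dim_prod => j; exact: shift_dim_coord.
have -> : (\prod_(i < d) \prod_(j < t.2 i) d = d ^ (\sum_(i < d) t.2 i))%N.
  by rewrite expn_sum; apply: eq_bigr => i _; rewrite prod_nat_const card_ord.
move=> [I cI /(shift_space_scale t.1) rI]; exists I => //;
  apply: shift_space_ext rI => k.
by rewrite /v; congr (_ * _); apply: eq_bigr => i _; rewrite prodr_const card_ord.
Qed.

Lemma payoff_killed (s : seq (rat * multinom d)) :
  exists p : {poly rat}, [/\ p \is monic, size p = (order_bound s).+1 &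
    kills p (payoff_seq (mpoly_of_terms s))].
Proof. by have [I <- /shift_space_killed] := shift_dim_payoff s. Qed.

Lemma mean_payoff_exists_sublinear (p : mpoly d rat) :
  mean_payoff_exists (poly_weight R p) M q <-> sublinear (payoff_seq p).
Proof.
rewrite /mean_payoff_exists payoff_averageE; split=> [|su].
  by move/cvg_average_sublinear/sublinear_ratr.
have [s pE] := mpoly_of_terms_surj p; have [p0 [mp _ kp]] := payoff_killed s.
rewrite -pE in kp; have [phi [phi1 kphi]] := averaging_poly_ex mp kp su.
by apply/cvg_ex; exists (ratr (act phi (payoff_seq p) 0)); apply: average_cvg.
Qed.

Lemma mean_payoffE (p : mpoly d rat) (phi : {poly rat}) :
  sublinear (payoff_seq p) -> phi.[1] = 1 ->
    kills (('X - 1) * phi) (payoff_seq p) ->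
  mean_payoff (poly_weight R p) M q = ratr (act phi (payoff_seq p) 0).
Proof.
move=> su phi1 kphi; rewrite /mean_payoff payoff_averageE.
by apply: cvg_lim => //; apply: average_cvg.
Qed.

End Payoff.

(** * The algorithms *)

(** All naturals are tried as codes, including those of no certificate, which [dec] still maps into
    [Z]. The certificate found need not be the given one, so the conclusion speaks of some accepted
    certificate. *)
Lemma certificate_search (Z T : Type) (eZ : Enc Z) (eT : Enc T)
    (check : nat -> Z -> bool) (result : nat -> Z -> T) :
  computable (dec : nat -> Z) ->
  computable (fun p : nat * Z => check p.1 p.2) ->
  computable (fun p : nat * Z => result p.1 p.2) ->
  exists f : recfun 1, forall c, (exists z, check c z) ->
    exists2 z, check c z & reval f [tuple c] (enc (result c z)).
Proof.
move=> cdec ccheck cresult.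
have cd : computable (fun p : nat * nat => dec p.2 : Z).
  by apply: (cp_comp cdec); exact: cp_snd cp_id.
have c1 : computable (fun p : nat * nat => p.1) by exact: cp_fst cp_id.
have [F [cF hF]] := cp_comp2 ccheck c1 cd.
have [H [cH hH]] := cp_comp2 cresult c1 cd.
have cpair2 (i j : 'I_2) : recursive (fun w : 2.-tuple nat =>
  cpair (tnth w i) (tnth w j)).
  by do 2?[apply: recursive_cons]; try exact: recursive_proj;
    exact: recursive_const.
(* [RMu] puts the tried number in front of the input, hence the swapped order in the pair. *)
have [fm hfm] : recursive (fun w : 2.-tuple nat =>
    (1 - F (cpair (tnth w (lift ord0 ord0)) (tnth w ord0)))%N).
  by apply: recursive_sub; [exact: recursive_const | exact: recursive_comp1].
have [fr hfr] : recursive (fun w : 2.-tuple nat =>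
    H (cpair (tnth w ord0) (tnth w (lift ord0 ord0)))).
  exact: recursive_comp1.
exists (RComp fr (fun i : 'I_2 => if i == ord0 then RProj ord0 else RMu fm)) => c
  [z cz].
have ex : exists k, check c (dec k) by exists (enc z); rewrite encK.
have FE k : F (cpair c k) = check c (dec k) :> nat by exact: (hF (c, k)).
case: (ex_minnP ex) => y cy min_y; exists (dec y) => //.
exists [tuple c; y]; split=> [i|]; last first.
  by rewrite -(hH (c, y)); exact: hfr.
case: (unliftP ord0 i) => [j|] -> //=; rewrite [j]ord1; split.
  by have := hfm [tuple of y :: [tuple c]]; rewrite /= FE cy.
move=> k lt_k; exists 0%N; have := hfm [tuple of k :: [tuple c]].
rewrite /= FE; case E : (check _ _) => //.
by have := min_y k E; rewrite leqNgt lt_k.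
Qed.

Section Programs.
Implicit Types (c k : nat).

(** The dimension is part of the input, so the programs work on plain lists in place of matrices and
    multinomials indexed by it. *)
Definition in_dim c : nat := chead c.
Definition in_mat c : seq (seq rat) := dec (chead (ctail c)).
Definition in_vec c : seq rat := dec (chead (ctail (ctail c))).
Definition in_terms c : seq (rat * seq nat) :=
  dec (chead (ctail (ctail (ctail c)))).

Definition orbit_prog c k : seq rat :=
  nat_rect (fun=> seq rat) (in_vec c)
    (fun _ v => mkseq (fun i =>
       \sum_(j < in_dim c) nth 0 (nth [::] (in_mat c) i) j * nth 0 v j)
       (in_dim c)) k.

Definition term_prog c (t : nat) : rat * seq nat := nth (0, [::]) (in_terms c) t.

Definition payoff_prog c k : rat :=
  \sum_(t < size (in_terms c)) (term_prog c t).1 *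
    \prod_(i < in_dim c) nth 0 (orbit_prog c k) i ^+ nth 0%N (term_prog c t).2 i.

Definition order_prog c : nat :=
  (\sum_(t < size (in_terms c))
     in_dim c ^ \sum_(i < in_dim c) nth 0%N (term_prog c t).2 i)%N.

Definition kills_prog c (p : {poly rat}) : bool :=
  [forall n : 'I_(order_prog c), act p (payoff_prog c) n == 0].

Lemma cp_in_dim : computable in_dim.
Proof. exact: cp_chead. Qed.

Lemma cp_in_mat : computable in_mat.
Proof.
exact: (cp_comp (cp_dec_seq (cp_dec_seq cp_dec_rat)) (cp_comp cp_chead cp_ctail)).
Qed.

Lemma cp_in_vec : computable in_vec.
Proof.
exact: (cp_comp (cp_dec_seq cp_dec_rat)
  (cp_comp cp_chead (cp_comp cp_ctail cp_ctail))).
Qed.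

Lemma cp_dec_nat : computable (dec : nat -> nat).
Proof. exact: cp_id. Qed.

Lemma cp_in_terms : computable in_terms.
Proof.
exact: (cp_comp (cp_dec_seq (cp_dec_pair cp_dec_rat (cp_dec_seq cp_dec_nat)))
  (cp_comp cp_chead (cp_comp cp_ctail (cp_comp cp_ctail cp_ctail)))).
Qed.

Lemma cp_orbit_prog : computable (fun p : nat * nat => orbit_prog p.1 p.2).
Proof.
have cd := cp_in_dim; have cm := cp_in_mat; have cv := cp_in_vec.
apply: (@cp_rec _ _ _ _ (fun p : nat * nat => in_vec p.1) (fun p => p.2)
  (fun p _ v => mkseq (fun i => \sum_(j < in_dim p.1)
     nth 0 (nth [::] (in_mat p.1) i) j * nth 0 v j) (in_dim p.1))); [by cp|by cp|].
apply: (@cp_mkseq _ _ _ _ (fun (x : nat * nat * nat * seq rat) i =>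
  \sum_(j < in_dim x.1.1.1) nth 0 (nth [::] (in_mat x.1.1.1) i) j * nth 0 x.2 j)
  (fun x => in_dim x.1.1.1)); last by cp.
apply: (@cp_rat_sum _ _ (fun y : nat * nat * nat * seq rat * nat =>
  in_dim y.1.1.1.1)
  (fun y j => nth 0 (nth [::] (in_mat y.1.1.1.1) y.2) j * nth 0 y.1.2 j)); by cp.
Qed.

Lemma cp_term_prog : computable (fun p : nat * nat => term_prog p.1 p.2).
Proof. have ct := cp_in_terms; rewrite /term_prog; by cp. Qed.

Lemma cp_payoff_prog : computable (fun p : nat * nat => payoff_prog p.1 p.2).
Proof.
have cd := cp_in_dim; have ct := cp_in_terms.
apply: (@cp_rat_sum _ _ (fun p : nat * nat => size (in_terms p.1)) (fun p t =>
  (term_prog p.1 t).1 * \prod_(i < in_dim p.1)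
     nth 0 (orbit_prog p.1 p.2) i ^+ nth 0%N (term_prog p.1 t).2 i)); first by cp.
apply: cp_ratM.
  by apply: cp_fst; apply: (cp_comp2 (h := term_prog) cp_term_prog); cp.
apply: (@cp_rat_prod _ _ (fun y : nat * nat * nat => in_dim y.1.1) (fun y i =>
  nth 0 (orbit_prog y.1.1 y.1.2) i ^+ nth 0%N (term_prog y.1.1 y.2).2 i));
    first by cp.
apply: cp_rat_exp; apply: cp_nth; try by cp.
  by apply: (cp_comp2 (h := orbit_prog) cp_orbit_prog); cp.
by apply: cp_snd; apply: (cp_comp2 (h := term_prog) cp_term_prog); cp.
Qed.

Lemma cp_order_prog : computable order_prog.
Proof.
have cd := cp_in_dim; have ct := cp_in_terms.
apply: (@cp_sumn _ _ (fun c => size (in_terms c)) (fun c t =>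
  (in_dim c ^ \sum_(i < in_dim c) nth 0 (term_prog c t).2 i)%N)); first by cp.
apply: cp_expn; first by cp.
apply: (@cp_sumn _ _ (fun y : nat * nat => in_dim y.1) (fun y i =>
  nth 0%N (term_prog y.1 y.2).2 i)); first by cp.
apply: cp_nth; last by cp.
by apply: cp_snd; apply: (cp_comp2 (h := term_prog) cp_term_prog); cp.
Qed.

Lemma cp_act_prog :
  computable (fun x : nat * {poly rat} * nat => act x.1.2 (payoff_prog x.1.1) x.2).
Proof.
apply: (@cp_rat_sum _ _ (fun x : nat * {poly rat} * nat => size x.1.2)
  (fun x i => x.1.2`_i * payoff_prog x.1.1 (x.2 + i)%N)); first by cp.
apply: cp_ratM; first by cp.
by apply: (cp_comp2 (h := payoff_prog) cp_payoff_prog); cp.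
Qed.

Lemma cp_kills_prog : computable (fun x : nat * {poly rat} => kills_prog x.1 x.2).
Proof.
have co := cp_order_prog.
apply: (@cp_forall _ _ (fun x : nat * {poly rat} => order_prog x.1)
  (fun x n => act x.2 (payoff_prog x.1) n == 0)); first by cp.
apply: cp_eq; [exact: cp_act_prog | by cp].
Qed.

Lemma cp_dominated (X : Type) (eX : Enc X) (p : X -> {poly rat}) :
  computable p -> computable (fun x => dominated (p x)).
Proof.
move=> cp'; apply: cp_rat_lt; last by rewrite /lead_coef; cp.
by apply: (@cp_rat_sum _ _ (fun x => (size (p x)).-1) (fun x i => `|(p x)`_i|)); cp.
Qed.

Lemma cp_self_reciprocal (X : Type) (eX : Enc X) (p : X -> {poly rat}) :
  computable p -> computable (fun x => self_reciprocal (p x)).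
Proof.
move=> cp'; apply: (@cp_forall _ _ (fun x => size (p x))
  (fun x i => (p x)`_i == (p x)`_0 * (p x)`_((size (p x)).-1 - i))); by cp.
Qed.

Lemma cp_growth_bound :
  computable (fun x : nat * nat =>
    growth_bound (order_prog x.1) (payoff_prog x.1) x.2).
Proof.
have co := cp_order_prog.
apply: cp_ratM; last by cp.
apply: cp_ratM; last by cp.
apply: (@cp_rat_sum _ _ (fun x : nat * nat => order_prog x.1)
  (fun x i => `|payoff_prog x.1 i|)); first by cp.
by apply: cp_normr; apply: (cp_comp2 (h := payoff_prog) cp_payoff_prog); cp.
Qed.

(* A growth witness [k], or a quadruple [f, g, h1, h2] certifying that the
   characteristic roots lie in the closed disc. *)
Definition cert_type : Type :=
  (nat * ({poly rat} * {poly rat} * ({poly rat} * {poly rat})))%type.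

Definition grows c (z : cert_type) : bool :=
  growth_bound (order_prog c) (payoff_prog c) z.1 < `|payoff_prog c z.1|.

Definition decision_check c (z : cert_type) : bool :=
  grows c z || certifies z.2.1.1 z.2.1.2 z.2.2.1 z.2.2.2
               && kills_prog c (z.2.1.1 ^+ order_prog c * z.2.1.2).

(* Meaningful only for the certificates accepted by [decision_check]. *)
Definition decision_result c (z : cert_type) : nat :=
  ~~ grows c z && kills_prog c (z.2.1.1 * z.2.1.2).

(** The sum of the coefficients is phi(1). *)
Definition value_check c (phi : {poly rat}) : bool :=
  (\sum_(i < size phi) phi`_i == 1) && kills_prog c (('X - 1) * phi).

Definition value_result c (phi : {poly rat}) : rat := act phi (payoff_prog c) 0.

Lemma cp_grows : computable (fun x : nat * cert_type => grows x.1 x.2).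
Proof.
apply: cp_rat_lt.
  by apply: (cp_comp2 (h := fun c k =>
      growth_bound (order_prog c) (payoff_prog c) k)
    cp_growth_bound); cp.
by apply: cp_normr; apply: (cp_comp2 (h := payoff_prog) cp_payoff_prog); cp.
Qed.

Lemma cp_decision_check :
  computable (fun x : nat * cert_type => decision_check x.1 x.2).
Proof.
have co := cp_order_prog.
apply: cp_orb; first exact: cp_grows.
have cf : computable (fun x : nat * cert_type => x.2.2.1.1) by cp.
have cg : computable (fun x : nat * cert_type => x.2.2.1.2) by cp.
have ch1 : computable (fun x : nat * cert_type => x.2.2.2.1) by cp.
have ch2 : computable (fun x : nat * cert_type => x.2.2.2.2) by cp.
apply: cp_andb; last first.
  apply: (cp_comp2 (h := kills_prog) cp_kills_prog); first by cp.
  by apply: cp_polyM => //; apply: cp_polyX => //; cp.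
apply: cp_andb; first by rewrite /lead_coef; cp.
apply: cp_andb; first by cp.
apply: cp_andb; first exact: cp_self_reciprocal.
by apply: cp_andb; apply: cp_dominated; apply: cp_polyM => //; apply: cp_deriv.
Qed.

Lemma cp_decision_result :
  computable (fun x : nat * cert_type => decision_result x.1 x.2).
Proof.
have cb : computable (fun x : nat * cert_type =>
    ~~ grows x.1 x.2 && kills_prog x.1 (x.2.2.1.1 * x.2.2.1.2)).
  apply: cp_andb; first by apply: cp_negb; exact: cp_grows.
  apply: (cp_comp2 (h := kills_prog) cp_kills_prog); first by cp.
  by apply: cp_polyM; cp.
by case: cb => F [cF hF]; exists F; split.
Qed.

Lemma cp_value_check : computable (fun x : nat * {poly rat} => value_check x.1 x.2).
Proof.
apply: cp_andb.
  apply: cp_eq; last by cp.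
  by apply: (@cp_rat_sum _ _ (fun x : nat * {poly rat} => size x.2)
    (fun x i => x.2`_i)); cp.
apply: (cp_comp2 (h := kills_prog) cp_kills_prog); first by cp.
by apply: cp_polyM; cp.
Qed.

Lemma cp_value_result :
  computable (fun x : nat * {poly rat} => value_result x.1 x.2).
Proof.
by apply: (cp_comp cp_act_prog (g := fun x : nat * {poly rat} => (x, 0%N))); cp.
Qed.

End Programs.

(** * Agreement of the programs with the mathematical objects *)

Section Correctness.
Variables (d : nat) (M : 'M[rat]_d) (q : 'cV[rat]_d) (s : seq (rat * multinom d)).
Let c := CodeSeq.code [:: d; code_mat M; code_vec q; code_terms s].
Let u := payoff_seq M q (mpoly_of_terms s).

Lemma in_dimE : in_dim c = d.
Proof. by rewrite /in_dim /c code_cons chead_cons. Qed.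

Lemma in_matE : in_mat c = [seq [seq M i j | j <- enum 'I_d] | i <- enum 'I_d].
Proof.
(* The input format is the [Enc] code of the list of rows, so that decoding reduces to [encK]. *)
rewrite /in_mat /c !code_cons ctail_cons chead_cons -[RHS]encK; congr dec.
by rewrite /= -map_comp.
Qed.

Lemma in_vecE : in_vec c = [seq q i 0 | i <- enum 'I_d].
Proof. by rewrite /in_vec /c !code_cons !ctail_cons chead_cons -[RHS]encK. Qed.

Lemma in_termsE : in_terms c =
  [seq (t.1, [seq (t.2 : multinom d) i | i <- enum 'I_d]) |
    t : rat * multinom d <- s].
Proof.
rewrite /in_terms /c !code_cons !ctail_cons chead_cons -[RHS]encK; congr dec.
rewrite /= -map_comp /code_terms; congr CodeSeq.code; apply: eq_map => t /=.
by rewrite /code_term /= map_id.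
Qed.

Lemma nth_map_enum (T : Type) (x0 : T) (F : 'I_d -> T) (i : 'I_d) :
  nth x0 [seq F j | j <- enum 'I_d] i = F i.
Proof. by rewrite (nth_map i) ?size_enum_ord // nth_ord_enum. Qed.

Lemma orbit_progE k : orbit_prog c k = [seq (M ^+ k *m q) i 0 | i <- enum 'I_d].
Proof.
elim: k => [|k IHk].
  by rewrite /orbit_prog /= in_vecE; apply: eq_map => i; rewrite expr0 mul1mx.
rewrite [LHS]/= -/(orbit_prog c k) IHk in_dimE in_matE.
apply: (@eq_from_nth _ 0); first by rewrite size_mkseq size_map size_enum_ord.
move=> i; rewrite size_mkseq => lt_i; rewrite nth_mkseq //.
rewrite -[i in RHS]/(nat_of_ord (Ordinal lt_i)) nth_map_enum.
rewrite exprS -mulmxE -mulmxA mxE; apply: eq_bigr => j _.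
by rewrite -[i]/(nat_of_ord (Ordinal lt_i)) !nth_map_enum.
Qed.

Let t0 : rat * multinom d := (0, mnm0).

Lemma size_in_terms : size (in_terms c) = size s.
Proof. by rewrite in_termsE size_map. Qed.

Lemma term_progE t : (t < size s)%N ->
  term_prog c t = ((nth t0 s t).1, [seq (nth t0 s t).2 i | i <- enum 'I_d]).
Proof. by move=> lt_t; rewrite /term_prog in_termsE (nth_map t0). Qed.

Lemma payoff_progE k : payoff_prog c k = u k.
Proof.
rewrite /u payoff_seq_terms /payoff_prog in_dimE size_in_terms.
rewrite (big_nth t0) big_mkord; apply: eq_bigr => t _.
rewrite term_progE //=; congr (_ * _); apply: eq_bigr => i _.
by rewrite orbit_progE !nth_map_enum.
Qed.

Lemma order_progE : order_prog c = order_bound s.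
Proof.
rewrite /order_prog /order_bound in_dimE size_in_terms.
rewrite (big_nth t0) big_mkord; apply: eq_bigr => t _.
rewrite term_progE //=; congr (_ ^ _)%N; apply: eq_bigr => i _.
by rewrite nth_map_enum.
Qed.

Lemma kills_progP p : reflect (kills p u) (kills_prog c p).
Proof.
have actE n : act p (payoff_prog c) n = act p u n.
  by apply: eq_act; exact: payoff_progE.
rewrite /kills_prog; apply: (iffP forallP) => [H|H i].
  have [p0 [mp sp kp]] := payoff_killed M q s.
  apply: (kills_from_init mp sp kp) => n lt_n.
  by rewrite -order_progE in lt_n; have /eqP := H (Ordinal lt_n); rewrite actE.
by rewrite actE H.
Qed.

Lemma growsE z : grows c z = (growth_bound (order_bound s) u z.1 < `|u z.1|).
Proof.
rewrite /grows order_progE payoff_progE; congr (_ < _).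
by congr (_ * _ * _); apply: eq_bigr => i _; rewrite payoff_progE.
Qed.

(** An index where the growth bound fails is a certificate by itself; otherwise [certificate_exists]
    applies. This classical case distinction only proves that the search stops. *)
Lemma decision_certificate_exists : exists z, decision_check c z.
Proof.
have [p0 [mp sp kp]] := payoff_killed M q s.
have [[k gk]|ng] := EM (exists k, growth_bound (order_bound s) u k < `|u k|).
  by exists (k, (0, 0, (0, 0))); rewrite /decision_check growsE gk.
have [|f [g [h1 [h2 [cert kN]]]]] := certificate_exists mp sp kp.
  by move=> k; rewrite leNgt; apply/negP => gk; apply: ng; exists k.
exists (0%N, (f, g, (h1, h2))); rewrite /decision_check cert order_progE /=.
by apply/orP; right; apply/kills_progP.
Qed.

Lemma decision_result_correct z : decision_check c z ->
  decision_result c z = 1%N /\ sublinear u \/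
  decision_result c z = 0%N /\ ~ sublinear u.
Proof.
have [p0 [mp sp kp]] := payoff_killed M q s.
rewrite /decision_check /decision_result growsE => /orP[gr|/andP[cert kN]].
  right; rewrite gr; split=> // /(sublinear_growth_bound mp sp kp)/(_ z.1).
  by rewrite leNgt gr.
have /kills_progP := kN => /(certified_decision cert) dec.
case: ltP => [gr|_] /=.
  right; split=> // /(sublinear_growth_bound mp sp kp)/(_ z.1).
  by rewrite leNgt gr.
case: kills_progP => k; [left|right]; split=> //; first exact/dec.
by move=> su; apply: k; exact/dec.
Qed.

End Correctness.

Theorem theorem10 (R : realType) :
  (exists f : recfun 1,
     forall (d : nat) (M : 'M[rat]_d) (q : 'cV[rat]_d) (p : mpoly d rat) (c : nat),
       (0 < d)%N -> encodes M q p c ->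
       (mean_payoff_exists (poly_weight R p) M q -> reval f [tuple c] 1%N) /\
       (~ mean_payoff_exists (poly_weight R p) M q -> reval f [tuple c] 0%N)) /\
  (exists g : recfun 1,
     forall (d : nat) (M : 'M[rat]_d) (q : 'cV[rat]_d) (p : mpoly d rat),
       (0 < d)%N -> mean_payoff_exists (poly_weight R p) M q ->
       exists r : rat,
         mean_payoff (poly_weight R p) M q = ratr r /\
         forall c : nat, encodes M q p c -> reval g [tuple c] (code_rat r)).
Proof.
have cdec : computable (dec : nat -> cert_type).
  by do ?[apply: cp_dec_pair]; try exact: cp_dec_poly; exact: cp_dec_nat.
split.
  have [f hf] := certificate_search cdec cp_decision_check cp_decision_result.
  exists f => d M q p c _ [s -> ->]; rewrite mean_payoff_exists_sublinear.
  have [z /decision_result_correct zr fz] :=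
    hf _ (decision_certificate_exists M q s).
  by case: zr fz => -[-> su] fz; split.
have [g hg] := certificate_search cp_dec_poly cp_value_check cp_value_result.
exists g => d M q p _ /mean_payoff_exists_sublinear su.
(* The polynomial phi found by the search depends on the list of terms that represents [p], while
   [r] has to be chosen before the code. *)
have value s : p = mpoly_of_terms s -> exists phi,
    [/\ phi.[1] = 1, kills (('X - 1) * phi) (payoff_seq M q p) &
    reval g [tuple CodeSeq.code [:: d; code_mat M; code_vec q; code_terms s]]
      (code_rat (act phi (payoff_seq M q p) 0))].
  move=> pE; have [p0 [mp _ kp]] := payoff_killed M q s.
  have horner1 (phi : {poly rat}) : phi.[1] = \sum_(i < size phi) phi`_i.
    by rewrite horner_coef; apply: eq_bigr => i _; rewrite expr1n mulr1.
  rewrite -pE in kp; have [phi0 [phi01 kphi0]] := averaging_poly_ex mp kp su.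
  have [|phi /andP[phi1 /kills_progP kphi] gphi] :=
      hg (CodeSeq.code [:: d; code_mat M; code_vec q; code_terms s]).
    by exists phi0; rewrite /value_check -horner1 phi01 eqxx; apply/kills_progP;
      rewrite -pE.
  exists phi; split; [by rewrite horner1; exact/eqP | by rewrite pE|].
  rewrite (_ : act phi (payoff_seq M q p) 0 =
    value_result (CodeSeq.code [:: d; code_mat M; code_vec q;
      code_terms s]) phi) //.
  by rewrite /value_result pE; apply: eq_act => k; rewrite payoff_progE.
have [s0 pE0] := mpoly_of_terms_surj M q p.
have [phi0 [phi01 kphi0 _]] := value s0 pE0.
exists (act phi0 (payoff_seq M q p) 0); split; first exact: mean_payoffE.
move=> c [s pE ->]; have [phi [phi1 kphi gphi]] := value s pE.
(* Both values are the mean payoff, and [ratr] is injective. *)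
suff -> : act phi0 (payoff_seq M q p) 0 = act phi (payoff_seq M q p) 0 by [].
have := mean_payoffE R su phi01 kphi0; rewrite (mean_payoffE R su phi1 kphi).
by move/fmorph_inj => ->.
Qed.
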